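(* Consider the dilation-invariant functional $\lambda_1(g)V(g)^{2/n}$ on metrics $g$ on the topological $n$-torus. (1) When $n=3$, every flat metric $g$ on the topological $3$-torus satisfies $\lambda_1(g)V(g)^{2/3}\le 4\sqrt[3]{2}\,\pi^2$, and equality is attained by the ($\lambda_1$-minimal) flat torus $\mathbb{R}^3/\Lambda_3$ for which the dual lattice $\Lambda_3^*$ has, with respect to some basis, the Gram matrix (up to a scaling) $$\begin{pmatrix}1&-\frac12&0\\-\frac12&1&-\frac12\\0&-\frac12&1\end{pmatrix}.$$ (2) When $n=4$, every flat metric $g$ on the topological $4$-torus satisfies $\lambda_1(g)V(g)^{2/4}\le 4\sqrt{2}\,\pi^2$, and equality is attained by the ($\lambda_1$-minimal) flat torus $\mathbb{R}^4/\mathrm{Span}_{\mathbb{Z}}\{e_1-e_4,\ e_2-e_4,\ e_3-e_4,\ 2e_4\}$ (with metric a constant multiple of the Euclidean one), where $e_1,\dots,e_4$ is the standard basis of $\mathbb{R}^4$.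
   Context: For a closed Riemannian manifold $(M^n,g)$, $V(g)$ denotes its volume and $\lambda_1(g)$ the first positive eigenvalue of its Laplacian. A flat metric on the topological $n$-torus is one isometric to the quotient metric on $\mathbb{R}^n/\Lambda$ for a rank $n$ lattice $\Lambda\subset\mathbb{R}^n$. The dual lattice is $\Lambda^*=\{\xi\in\mathbb{R}^n:\langle\xi,v\rangle\in\mathbb{Z}\ \text{for all } v\in\Lambda\}$. A flat torus is called $\lambda_1$-minimal if, after a constant rescaling of its metric, it admits an isometric minimal immersion into some unit sphere all of whose coordinate functions are eigenfunctions for the first eigenvalue. *)

(* Defs.v *)
From HB Require Import structures.
From mathcomp Require Import all_boot all_order all_algebra.
From mathcomp Require Import all_classical all_reals all_analysis.
Set Implicit Arguments.
Unset Strict Implicit.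
Unset Printing Implicit Defensive.
Import Order.TTheory GRing.Theory Num.Theory.
Import numFieldNormedType.Exports.
Local Open Scope classical_set_scope.
Local Open Scope ring_scope.

(* A flat torus R^n/L is given by an invertible matrix B whose rows form a
   basis of the rank n lattice L.  Functions on R^n/L are L-periodic functions
   on R^n, and the quotient metric is read on R^n as the Euclidean metric. *)

Section FlatTorus.
Context {R : realType} {n : nat}.
Implicit Types (L : set 'rV[R]_n) (B D : 'M[R]_n) (f : 'rV[R]_n -> R).

Definition dot {m : nat} (u v : 'rV[R]_m) : R := \sum_i u 0 i * v 0 i.

Definition lattice B : set 'rV[R]_n :=
  [set v | exists z : 'rV[int]_n, v = map_mx intr z *m B].

Definition dual_lattice L : set 'rV[R]_n :=
  [set xi | forall v, L v -> dot xi v \is a Num.int].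

Definition lattice_basis L B : Prop := B \in unitmx /\ L = lattice B.

(* Riemannian volume of R^n/L, for L the lattice with basis B: the metric of
   R^n/L in the coordinates t |-> t *m B, t in [0, 1]^n, has the constant
   volume density sqrt (\det (B *m B^T)) = `|\det B|. *)
Definition volume B : R := `|\det B|.

Definition periodic {T : Type} L (f : 'rV[R]_n -> T) : Prop :=
  forall v, L v -> forall x, f (x + v) = f x.

Definition partial (i : 'I_n) f : 'rV[R]_n -> R :=
  fun x => 'D_(delta_mx 0 i) f x.

Fixpoint class_C (k : nat) f : Prop :=
  continuous f /\
  if k is k'.+1 then
    forall i : 'I_n, (forall x, derivable f x (delta_mx 0 i)) /\
                     class_C k' (partial i f)
  else True.

Definition smooth f : Prop := forall k, class_C k f.

Definition laplacian f : 'rV[R]_n -> R :=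
  fun x => \sum_i partial i (partial i f) x.

(* Sign convention: the Laplacian of R^n/L is the nonnegative operator
   - \sum_i d_i^2. *)
Definition eigenfunction L (l : R) f : Prop :=
  [/\ smooth f, periodic L f, exists x, f x != 0
    & forall x, - laplacian f x = l * f x].

Definition laplace_eigenvalue L (l : R) : Prop := exists f, eigenfunction L l f.

(* The spectrum is discrete, so this infimum is a minimum. *)
Definition lambda1 L : R := inf [set l | 0 < l /\ laplace_eigenvalue L l].

Definition lambda1_vol B : R :=
  lambda1 (lattice B) * volume B `^ (2 / n%:R).

Section Immersion.
Context {N : nat}.
Implicit Types u : 'rV[R]_n -> 'rV[R]_N.

Definition coordinate u (j : 'I_N) : 'rV[R]_n -> R := fun x => u x 0 j.

Definition partial_map (i : 'I_n) u : 'rV[R]_n -> 'rV[R]_N :=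
  fun x => \row_j partial i (coordinate u j) x.

Definition first_form u (x : 'rV[R]_n) : 'M[R]_n :=
  \matrix_(i, j) dot (partial_map i u x) (partial_map j u x).

(* Component of w normal to the image of u inside the unit sphere, i.e.
   orthogonal to u x and to all d_i u x, when `|u| = 1 and u is an immersion. *)
Definition normal_part u (x : 'rV[R]_n) (w : 'rV[R]_N) : 'rV[R]_N :=
  w - dot w (u x) *: u x
    - \sum_i \sum_j (invmx (first_form u x) i j * dot w (partial_map i u x))
                      *: partial_map j u x.

Definition second_form u (x : 'rV[R]_n) (i j : 'I_n) : 'rV[R]_N :=
  normal_part u x (partial_map i (partial_map j u) x).

Definition mean_curvature u (x : 'rV[R]_n) : 'rV[R]_N :=
  \sum_i \sum_j invmx (first_form u x) i j *: second_form u x i j.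

(* The immersion condition follows from first_form u x = 1%:M. *)
Definition lambda1_minimal_immersion L u : Prop :=
  [/\ periodic L u /\ (forall j, smooth (coordinate u j)),
      forall x, dot (u x) (u x) = 1,
      forall x, first_form u x = 1%:M,
      forall x, mean_curvature u x = 0
    & forall j, eigenfunction L (lambda1 L) (coordinate u j)].

End Immersion.

(* R^n/L with its metric multiplied by r ^+ 2 is isometric to R^n/(r L). *)
Definition lambda1_minimal B : Prop :=
  exists r : R, 0 < r /\
  exists (N : nat) (u : 'rV[R]_n -> 'rV[R]_N),
    lambda1_minimal_immersion (lattice (r *: B)) u.

Definition dual_has_gram B (G : 'M[R]_n) : Prop :=
  exists D : 'M[R]_n, lattice_basis (dual_lattice (lattice B)) D /\
  exists s : R, 0 < s /\ D *m D^T = s *: G.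

End FlatTorus.

Definition seqs_mx {R : realType} (n : nat) (s : seq (seq R)) : 'M[R]_n :=
  \matrix_(i, j) nth 0 (nth [::] s i) j.

Definition gram3 (R : realType) : 'M[R]_3 :=
  seqs_mx 3 [:: [::      1; - 2^-1;      0 ];
                [:: - 2^-1;      1; - 2^-1 ];
                [::      0; - 2^-1;      1 ] ].

(* rows e1 - e4, e2 - e4, e3 - e4, 2 e4 *)
Definition basis4 (R : realType) : 'M[R]_4 :=
  seqs_mx 4 [:: [:: 1; 0; 0; -1 ];
                [:: 0; 1; 0; -1 ];
                [:: 0; 0; 1; -1 ];
                [:: 0; 0; 0;  2 ] ].

(* Main.v *)
(** Both extremal lattices are homothetic to the dual of the root lattice D_n
    (n = 3, 4): they contain an orthogonal frame p_1, ..., p_n of vectors of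
    equal square norm c together with half the sum of the p_i.

    Upper bound: every dual vector xi gives the eigenfunctions
    cos (2 pi xi.x + p), so lambda_1 / (4 pi^2) is at most the minimum of the
    dual lattice, and one needs the Hermite constants.  In rank 3 a basis whose
    Gram matrix has minimal trace satisfies Seeber's inequalities, which force
    abc <= 2 det because the relevant polynomial is concave along the edges of
    the reduction polytope.  Rank 4 follows by Mordell's argument: the section
    of the lattice orthogonal to a primitive dual vector has rank 3.

    Equality: an eigenfunction is sampled on the grid spanned by the p_i / N.
    The discrete Laplacian approximates the Laplacian with error O(1/N), and by
    discrete Fourier analysis its non-zero eigenvalues on functions invariant
    under the half-sum translation are at least 4 (1 - cos (2 pi / N)); letting
    N grow gives lambda_1 >= 8 pi^2 / c.  The immersion has for coordinates the
    waves attached to the roots (p_i +- p_j) / c, which form a tight frame. *)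

From mathcomp Require Import all_boot all_order all_fingroup all_algebra.
From mathcomp Require Import all_classical all_reals all_analysis.
From mathcomp Require Import ring lra zify.
Require Import Defs.
Set Implicit Arguments.
Unset Strict Implicit.
Unset Printing Implicit Defensive.
Import Order.TTheory GRing.Theory Num.Theory.
Import numFieldNormedType.Exports.
Local Open Scope classical_set_scope.
Local Open Scope ring_scope.

(** * Seeber reduction and Hermite constants in ranks 3 and 4 *)

(** A concave parabola lies above its chord: multiplied by [u], the value at [x] is the chord
    between the values at [0] and [u] plus [a u x (u - x)]. *)
Lemma concave_quadratic_ge0 (R : realFieldType) (a k l u x : R) :
  0 <= a -> 0 <= x <= u -> 0 <= k -> 0 <= k + l * u - a * u ^+ 2 ->
  0 <= k + l * x - a * x ^+ 2.
Proof.
move=> a0 /andP[x0 xu] k0 ku0.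
have [u0|u0] := eqVneq u 0; first by have x_0 : x = 0; [lra|rewrite x_0; lra].
have up : 0 < u by rewrite lt_def u0; lra.
rewrite -(pmulr_rge0 _ up).
have -> : u * (k + l * x - a * x ^+ 2) =
  (u - x) * k + x * (k + l * u - a * u ^+ 2) + a * (u * (x * (u - x))) by ring.
by rewrite !addr_ge0 ?mulr_ge0 //; lra.
Qed.

(** The expression is [2 det - a b c] for the Gram matrix with diagonal [a, b, c], where [p] pairs
    the vectors of square norms [b, c], [q] those of [a, c] and [r] those of [a, b]. It is concave
    in each of [p, q, r] separately, so it suffices to check the vertices of the box ([key]); [keyr]
    and [keyq] then free one variable at a time. *)
Lemma seeber_acute (R : realFieldType) (a b c p q r : R) :
  0 < a -> a <= b -> b <= c ->
  0 <= p <= b / 2 -> 0 <= q <= a / 2 -> 0 <= r <= a / 2 ->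
  0 <= a * b * c + 4 * (p * q * r) - 2 * (a * p ^+ 2 + b * q ^+ 2 + c * r ^+ 2).
Proof.
move=> a0 ab bc pb qa ra.
have key p' q' r' : p' = 0 \/ p' = b / 2 -> q' = 0 \/ q' = a / 2 ->
    r' = 0 \/ r' = a / 2 ->
  0 <= a * b * c + 4 * (p' * q' * r')
       - 2 * (a * p' ^+ 2 + b * q' ^+ 2 + c * r' ^+ 2).
  have h1 : 0 <= a * b * (c - b) by rewrite !mulr_ge0 //; lra.
  have h2 : 0 <= a * c * (b - a) by rewrite !mulr_ge0 //; lra.
  have h3 : 0 <= a * b * (c - a) by rewrite !mulr_ge0 //; lra.
  have h4 : 0 <= a * (b * c) by rewrite !mulr_ge0 //; lra.
  by case=> ->; case=> ->; case=> ->; nra.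
have keyr p' q' : p' = 0 \/ p' = b / 2 -> q' = 0 \/ q' = a / 2 ->
  0 <= a * b * c + 4 * (p' * q' * r)
       - 2 * (a * p' ^+ 2 + b * q' ^+ 2 + c * r ^+ 2).
  move=> hp hq.
  have := @concave_quadratic_ge0 R (2 * c)
    (a * b * c - 2 * (a * p' ^+ 2 + b * q' ^+ 2)) (4 * (p' * q')) (a / 2) r.
  have := key p' q' 0 hp hq (or_introl erefl).
  have := key p' q' (a / 2) hp hq (or_intror erefl).
  move=> h1 h2 h; suff: 0 <= a * b * c - 2 * (a * p' ^+ 2 + b * q' ^+ 2) +
     4 * (p' * q') * r - 2 * c * r ^+ 2 by lra.
  by apply: h => //; lra.
have keyq p' : p' = 0 \/ p' = b / 2 ->
  0 <= a * b * c + 4 * (p' * q * r)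
       - 2 * (a * p' ^+ 2 + b * q ^+ 2 + c * r ^+ 2).
  move=> hp.
  have := @concave_quadratic_ge0 R (2 * b)
    (a * b * c - 2 * (a * p' ^+ 2 + c * r ^+ 2)) (4 * (p' * r)) (a / 2) q.
  have := keyr p' 0 hp (or_introl erefl).
  have := keyr p' (a / 2) hp (or_intror erefl).
  move=> h1 h2 h; suff: 0 <= a * b * c - 2 * (a * p' ^+ 2 + c * r ^+ 2) +
     4 * (p' * r) * q - 2 * b * q ^+ 2 by lra.
  by apply: h => //; lra.
have := @concave_quadratic_ge0 R (2 * a)
    (a * b * c - 2 * (b * q ^+ 2 + c * r ^+ 2)) (4 * (q * r)) (b / 2) p.
have := keyq 0 (or_introl erefl).
have := keyq (b / 2) (or_intror erefl).
move=> h1 h2 h; suff: 0 <= a * b * c - 2 * (b * q ^+ 2 + c * r ^+ 2) +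
     4 * (q * r) * p - 2 * a * p ^+ 2 by lra.
by apply: h => //; lra.
Qed.

(** When the off-diagonal entries have a negative product, [2 det - a b c] can be negative at the
    far corner of the box; the cut [2 (p + q + r) <= a + b] removes that corner. The faces that
    remain are swept by segments along which the expression is concave. *)
Lemma seeber_obtuse (R : realFieldType) (a b c p q r : R) :
  0 < a -> a <= b -> b <= c ->
  0 <= p <= b / 2 -> 0 <= q <= a / 2 -> 0 <= r <= a / 2 ->
  2 * (p + q + r) <= a + b ->
  0 <= a * b * c - 4 * (p * q * r) - 2 * (a * p ^+ 2 + b * q ^+ 2 + c * r ^+ 2).
Proof.
move=> a0 ab bc pb qa ra pqr.
have h1 : 0 <= a * b * (c - b) by rewrite !mulr_ge0 //; lra.
have h2 : 0 <= a * c * (b - a) by rewrite !mulr_ge0 //; lra.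
have h3 : 0 <= a * b * (c - a) by rewrite !mulr_ge0 //; lra.
have p2 : p ^+ 2 <= (b / 2) ^+ 2 by rewrite lerXn2r ?nnegrE; lra.
have q2 : q ^+ 2 <= (a / 2) ^+ 2 by rewrite lerXn2r ?nnegrE; lra.
have r_0 : 0 <= a * b * c - 2 * (a * p ^+ 2 + b * q ^+ 2).
  have := ler_wpM2l (ltW a0) p2; have b0 : 0 <= b by lra.
  by have := ler_wpM2l b0 q2; lra.
(* The face [r = a / 2]: concavity in [p'] up to the cut [p' + q = b / 2], then concavity in [q]
   along that edge. *)
have r_max p' : 0 <= p' -> p' + q <= b / 2 ->
  0 <= a * b * c - 2 * a * (p' * q) - 2 * (a * p' ^+ 2 + b * q ^+ 2)
       - c * a ^+ 2 / 2.
  move=> p'0 p'q.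
  have := @concave_quadratic_ge0 R (2 * a)
    (a * b * c - 2 * b * q ^+ 2 - c * a ^+ 2 / 2) (- 2 * a * q) (b / 2 - q) p'.
  move=> h; suff: 0 <= a * b * c - 2 * b * q ^+ 2 - c * a ^+ 2 / 2 +
     - 2 * a * q * p' - 2 * a * p' ^+ 2 by lra.
  apply: h; [lra|lra| |].
    have b0 : 0 <= b by lra.
    by have := ler_wpM2l b0 q2; lra.
  have := @concave_quadratic_ge0 R (2 * b)
    (a * b * c - a * b ^+ 2 / 2 - c * a ^+ 2 / 2) (a * b) (a / 2) q.
  move=> h; suff: 0 <= a * b * c - a * b ^+ 2 / 2 - c * a ^+ 2 / 2 +
     a * b * q - 2 * b * q ^+ 2 by lra.
  by apply: h; [lra|lra|lra|lra].
(* The largest admissible [r] is [a / 2] below this threshold and [(a + b) / 2 - p - q] above it. *)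
have [pq|pq] := lerP (p + q) (b / 2).
  have := @concave_quadratic_ge0 R (2 * c)
    (a * b * c - 2 * (a * p ^+ 2 + b * q ^+ 2)) (- 4 * (p * q)) (a / 2) r.
  move=> h; suff: 0 <= a * b * c - 2 * (a * p ^+ 2 + b * q ^+ 2) +
     - 4 * (p * q) * r - 2 * c * r ^+ 2 by lra.
  apply: h; [lra|lra|lra|].
  have p0 : 0 <= p by lra.
  by have := r_max p p0 pq; lra.
have := @concave_quadratic_ge0 R (2 * c)
    (a * b * c - 2 * (a * p ^+ 2 + b * q ^+ 2)) (- 4 * (p * q))
    ((a + b) / 2 - p - q) r.
move=> h; suff: 0 <= a * b * c - 2 * (a * p ^+ 2 + b * q ^+ 2) +
     - 4 * (p * q) * r - 2 * c * r ^+ 2 by lra.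
apply: h; [lra|lra|lra|].
(* On the face [p + q + r = (a + b) / 2] with [q] fixed, [t] runs from the edge [r = a / 2] (at
   [t = 0]) to the edge [p = b / 2] (at [t = q]). The coefficient of [t ^+ 2] is
   [- 2 (a + c - 2 q)], so concavity persists. *)
set t := p - (b / 2 - q).
have aq : 0 <= a + c - 2 * q by lra.
have := @concave_quadratic_ge0 R (2 * (a + c - 2 * q))
    (a * b * c - 2 * (a * (b / 2 - q) ^+ 2 + b * q ^+ 2)
      - 4 * ((b / 2 - q) * q) * (a / 2) - 2 * c * (a / 2) ^+ 2)
    (- 4 * a * (b / 2 - q) - 4 * q * (a / 2) + 4 * q * (b / 2 - q)
     + 4 * c * (a / 2))
    q t.
move=> {}h; rewrite /t in h.
set Y := (Y in 0 <= _ -> _ -> _ -> _ -> 0 <= Y) in h.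
suff: 0 <= Y by rewrite /Y; lra.
apply: h; [by lra|by lra| |].
  by have := r_max (b / 2 - q); lra.
have := @concave_quadratic_ge0 R (2 * c)
  (a * b * c - a * b ^+ 2 / 2 - c * a ^+ 2 / 2) (2 * a * c - a * b) (a / 2) q.
move=> h; suff: 0 <= a * b * c - a * b ^+ 2 / 2 - c * a ^+ 2 / 2 +
     (2 * a * c - a * b) * q - 2 * c * q ^+ 2 by lra.
by apply: h; [lra|lra|lra|lra].
Qed.

(** Reversing a basis vector changes the sign of two of [p, q, r], so besides absolute values only
    the sign of [p q r] matters. The last four hypotheses are the cut of the obtuse case in its four
    sign patterns. *)
Lemma seeber_sorted (R : realFieldType) (a b c p q r : R) :
  0 < a -> a <= b -> b <= c ->
  2 * `|p| <= b -> 2 * `|q| <= a -> 2 * `|r| <= a ->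
  0 <= a + b + 2 * (p + q + r) -> 0 <= a + b + 2 * (p - q - r) ->
  0 <= a + b + 2 * (- p + q - r) -> 0 <= a + b + 2 * (- p - q + r) ->
  a * b * c <=
    2 * (a * b * c + 2 * (p * q * r) - a * p ^+ 2 - b * q ^+ 2 - c * r ^+ 2).
Proof.
move=> a0 ab bc pb qa ra s1 s2 s3 s4.
have := @seeber_acute R a b c `|p| `|q| `|r| a0 ab bc.
have := @seeber_obtuse R a b c `|p| `|q| `|r| a0 ab bc.
rewrite !normr_ge0 /= !real_normK ?num_real //.
have hp : `|p| <= b / 2 by lra.
have hq : `|q| <= a / 2 by lra.
have hr : `|r| <= a / 2 by lra.
move=> /(_ hp hq hr) ho /(_ hp hq hr) ha.
rewrite -subr_ge0.
move: ho ha {ab bc pb qa ra hp hq hr a0}.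
case: (ger0P p) => _; case: (ger0P q) => _; case: (ger0P r) => _ ho ha;
 by [(move: ha => /le_trans; apply; lra)|have := ho ltac:(lra); move/le_trans; apply; lra].
Qed.

(** * Unimodular changes of basis and bases of minimal trace *)

Notation intmx U := (map_mx intr U).

Lemma intmx_mul (R : realType) (m n p : nat) (U : 'M[int]_(m, n)) (V : 'M[int]_(n, p)) :
  intmx (U *m V) = intmx U *m intmx V :> 'M[R]_(m, p).
Proof. exact: (map_mxM intr). Qed.

Lemma intmx_mulV (R : realType) (n : nat) (U : 'M[int]_n) :
  U \in unitmx -> intmx U *m intmx (invmx U) = 1%:M :> 'M[R]_n.
Proof. by move=> uU; rewrite -intmx_mul mulmxV // (map_mx1 intr). Qed.

Lemma intmx_unit (R : realType) (n : nat) (U : 'M[int]_n) :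
  U \in unitmx -> intmx U \in @unitmx R n.
Proof. by move=> uU; have [] := mulmx1_unit (@intmx_mulV R n U uU). Qed.

Lemma norm_det_intmx (R : realType) (n : nat) (U : 'M[int]_n) :
  U \in unitmx -> `|\det (intmx U : 'M[R]_n)| = 1.
Proof.
rewrite unitmxE => /orP[]/eqP d.
  by rewrite (det_map_mx intr) d normr1.
by rewrite (det_map_mx intr) d normrN1.
Qed.

Lemma dot_gram (R : realType) (m n : nat) (A : 'M[R]_(m, n)) i j :
  (A *m A^T) i j = dot (row i A) (row j A).
Proof. by rewrite !mxE; apply: eq_bigr => k _; rewrite !mxE. Qed.

Lemma dot_ge0 (R : realType) (n : nat) (v : 'rV[R]_n) : 0 <= dot v v.
Proof. by apply: sumr_ge0 => i _; rewrite -expr2 sqr_ge0. Qed.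

Lemma entry_le_dot (R : realType) (n : nat) (v : 'rV[R]_n) k :
  `|v 0 k| <= 1 + dot v v.
Proof.
have h : v 0 k ^+ 2 <= dot v v.
  rewrite /dot (bigD1 k) //= -expr2 lerDl sumr_ge0 // => j _.
  by rewrite -expr2 sqr_ge0.
rewrite -real_normK ?num_real // in h.
have : 0 <= (`|v 0 k| - 1) ^+ 2 by exact: sqr_ge0.
have := normr_ge0 (v 0 k); nra.
Qed.

(** [X] is a right inverse of [A], so [U] is recovered from [W = U A], whose entries are controlled
    by the trace of its Gram matrix. *)
Lemma intmx_bounded (R : realType) (m n : nat) (A : 'M[R]_(m, n)) (T : R) :
  A *m A^T \in unitmx ->
  exists b : nat, forall U : 'M[int]_m,
    \tr (intmx U *m A *m (intmx U *m A)^T) <= T ->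
    forall i j, `|U i j| <= b%:Z.
Proof.
move=> uG; pose X := A^T *m invmx (A *m A^T).
pose S : R := \sum_k \sum_j `|X k j|.
have S0 : 0 <= S by apply: sumr_ge0 => k _; apply: sumr_ge0.
have [b hb] : exists b : nat, (1 + T) * S <= b%:R.
  exists (Num.bound `|(1 + T) * S|).
  exact: le_trans (ler_norm _) (ltW (archi_boundP (normr_ge0 _))).
exists b => U; set W := intmx U *m A => trW i j.
have UE : intmx U = W *m X.
  by rewrite /W /X -mulmxA (mulmxA A) mulmxV // mulmx1.
rewrite -(ler_int R) intr_norm.
have -> : (U i j)%:~R = (W *m X) i j :> R by rewrite -UE mxE.
rewrite mxE; apply: le_trans (ler_norm_sum _ _ _) _; apply: le_trans _ hb.
rewrite mulr_sumr; apply: ler_sum => k _; rewrite normrM.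
apply: ler_pM => //.
  apply: le_trans (_ : 1 + dot (row i W) (row i W) <= _).
    by have := entry_le_dot (row i W) k; rewrite mxE.
  rewrite lerD2l; apply: le_trans trW; rewrite /mxtrace (bigD1 i) //= dot_gram lerDl.
  by apply: sumr_ge0 => l _; rewrite dot_gram dot_ge0.
by rewrite (bigD1 j) //= lerDl sumr_ge0.
Qed.

(** Bases whose trace does not exceed that of [A] have bounded coordinates, so there are finitely
    many. The minimum is taken over matrices with entries in ['I_b.*2.+1], which encode the integers
    from [-b] to [b]. *)
Lemma trace_minimal_basis (R : realType) (m n : nat) (A : 'M[R]_(m, n)) :
  A *m A^T \in unitmx ->
  exists2 U : 'M[int]_m, U \in unitmx & forall V : 'M[int]_m, V \in unitmx ->
    \tr (intmx U *m A *m (intmx U *m A)^T) <=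
    \tr (intmx V *m A *m (intmx V *m A)^T).
Proof.
move=> uG.
pose F (U : 'M[int]_m) : R := \tr (intmx U *m A *m (intmx U *m A)^T).
have [b hb] := intmx_bounded (F 1%:M) uG.
pose dec (x : 'M['I_b.*2.+1]_m) : 'M[int]_m := \matrix_(i, j) ((x i j : nat)%:Z - b%:Z).
pose enc (U : 'M[int]_m) : 'M['I_b.*2.+1]_m := \matrix_(i, j) inord (absz (U i j + b%:Z)).
have decK (U : 'M[int]_m) : F U <= F 1%:M -> dec (enc U) = U.
  move=> /hb bU; apply/matrixP => i j; rewrite !mxE inordK; first by have := bU i j; lia.
  by have := bU i j; lia.
have P0 : dec (enc 1%:M) \in unitmx by rewrite decK // unitmx1.
case: (@arg_minP _ R _ (enc 1%:M) (fun x => dec x \in unitmx) (F \o dec) P0).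
move=> x ux xmin; exists (dec x) => // V uV; rewrite -!/(F _).
have [le1|/ltW lt1] := lerP (F V) (F 1%:M).
  by rewrite -(decK V le1); apply: xmin; rewrite decK.
by apply: le_trans lt1; rewrite -[X in _ <= F X]decK //; apply: xmin; rewrite decK // unitmx1.
Qed.

(** [delta_mx i 0 *m s] squares to zero because [s] vanishes at [i], so reversing its sign gives the
    inverse. *)
Lemma elementary_unitmx (m : nat) (i : 'I_m) (s : 'rV[int]_m) :
  s 0 i = 0 -> 1%:M + delta_mx i 0 *m s \in unitmx.
Proof.
move=> si.
suff /mulmx1_unit[//] : (1%:M + delta_mx i 0 *m s) *m (1%:M - delta_mx i 0 *m s) = 1%:M.
have NN : (delta_mx i 0 *m s) *m (delta_mx i 0 *m s) = 0 :> 'M[int]_m.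
  rewrite mulmxA -(mulmxA (delta_mx i 0)) -colE.
  have -> : col i s = 0 by apply/matrixP => a b; rewrite !mxE ord1.
  by rewrite mulmx0 mul0mx.
by rewrite mulmxBr mulmx1 mulmxDl mul1mx NN addr0 addrK.
Qed.

(** Adding to one basis vector an integer combination of the others changes a single diagonal term
    of the trace, so minimality of the trace forbids shortening that vector. *)
Lemma trace_minimal_row (R : realType) (m n : nat) (A : 'M[R]_(m, n))
    (U : 'M[int]_m) : U \in unitmx ->
  (forall V : 'M[int]_m, V \in unitmx ->
    \tr (intmx U *m A *m (intmx U *m A)^T) <=
    \tr (intmx V *m A *m (intmx V *m A)^T)) ->
  forall (i : 'I_m) (s : 'rV[int]_m), s 0 i = 0 ->
  forall W : 'M[R]_(m, n), W = intmx U *m A ->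
  dot (row i W) (row i W) <=
  dot (row i W + intmx s *m W) (row i W + intmx s *m W).
Proof.
move=> uU minU i s si W WE.
have := minU ((1%:M + delta_mx i 0 *m s) *m U).
rewrite unitmx_mul elementary_unitmx // uU => /(_ isT).
rewrite intmx_mul -(mulmxA _ (intmx U)) -WE /mxtrace.
set W' := (X in _ <= \sum_i (X *m X^T) i i).
have W'E j : row j W' = row j W + (j == i)%:R *: (intmx s *m W).
  rewrite /W' (map_mxD intr) (map_mx1 intr) intmx_mul mulmxDl mul1mx.
  rewrite raddfD /= -mulmxA row_mul; congr (_ + _).
  apply/matrixP => a b; rewrite !ord1 mxE big_ord1 !mxE.
  by rewrite eqxx andbT; case: (j == i).
rewrite (bigD1 i) //= [X in _ <= X](bigD1 i) //= !dot_gram W'E eqxx scale1r.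
rewrite [X in _ <= _ + X](eq_bigr (fun j => (W *m W^T) j j)); last first.
  by move=> j ji; rewrite !dot_gram W'E (negbTE ji) scale0r addr0.
by rewrite lerD2r.
Qed.

(** The hypotheses say that no basis vector is shortened by adding plus or minus one other vector,
    or a signed sum of both others. They are symmetric in the three vectors, so the six orders of
    [a, b, c] all reduce to the sorted case. *)
Lemma seeber (R : realFieldType) (m a b c p q r : R) :
  0 < m -> m <= a -> m <= b -> m <= c ->
  (forall s, s = 1 \/ s = -1 ->
    [/\ 0 <= b + 2 * (s * p), 0 <= c + 2 * (s * p), 0 <= a + 2 * (s * q),
        0 <= c + 2 * (s * q) & 0 <= a + 2 * (s * r) /\ 0 <= b + 2 * (s * r)]) ->
  (forall s t, s = 1 \/ s = -1 -> t = 1 \/ t = -1 ->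
    let w := 2 * (s * p + t * q + s * t * r) in
    [/\ 0 <= a + b + w, 0 <= a + c + w & 0 <= b + c + w]) ->
  m ^+ 3 <=
    2 * (a * b * c + 2 * (p * q * r) - a * p ^+ 2 - b * q ^+ 2 - c * r ^+ 2).
Proof.
move=> m0 ma mb mc h1 h2.
have mabc : m ^+ 3 <= a * b * c.
  by rewrite -[m ^+ 3]/(m * (m * m)) -mulrA !ler_pM ?mulr_ge0 //; lra.
have pos : 1 = 1 :> R \/ 1 = -1 :> R by left.
have neg : -1 = 1 :> R \/ -1 = -1 :> R by right.
have [p1 p2 p3 p4 [p5 p6]] := h1 _ pos.
have [n1 n2 n3 n4 [n5 n6]] := h1 _ neg.
have /= [x1 x2 x3] := h2 _ _ pos pos.
have /= [y1 y2 y3] := h2 _ _ pos neg.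
have /= [z1 z2 z3] := h2 _ _ neg pos.
have /= [t1 t2 t3] := h2 _ _ neg neg.
apply: (le_trans mabc).
have nle (x y : R) : 0 <= y + 2 * (1 * x) -> 0 <= y + 2 * (-1 * x) -> 2 * `|x| <= y.
  by move=> k1 k2; case: (ger0P x) => _; lra.
have := nle _ _ p1 n1; have := nle _ _ p2 n2; have := nle _ _ p3 n3.
have := nle _ _ p4 n4; have := nle _ _ p5 n5; have := nle _ _ p6 n6.
move=> k1 k2 k3 k4 k5 k6.
have a0 : 0 < a by lra.
have b0 : 0 < b by lra.
have c0 : 0 < c by lra.
move: x1 x2 x3 y1 y2 y3 z1 z2 z3 t1 t2 t3; rewrite !(mul1r, mulN1r, mulr1, mulrN1, opprK).
move=> x1 x2 x3 y1 y2 y3 z1 z2 z3 t1 t2 t3.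
clear h1 h2 p1 p2 p3 p4 p5 p6 n1 n2 n3 n4 n5 n6 nle mabc m0 ma mb mc.
have [ab|/ltW ba] := lerP a b.
  have [bc|/ltW cb] := lerP b c.
    by apply: seeber_sorted => //; lra.
  have [ac|/ltW ca] := lerP a c.
    have := @seeber_sorted R a c b p r q; rewrite (_ : a * c * b = a * b * c); last by ring.
    rewrite (_ : p * r * q = p * q * r); last by ring.
    by move=> h; rewrite addrAC; apply: h => //; lra.
  have := @seeber_sorted R c a b r p q; rewrite (_ : c * a * b = a * b * c); last by ring.
  rewrite (_ : r * p * q = p * q * r); last by ring.
  move=> h.
  rewrite [X in 2 * X](_ : _ = a * b * c + 2 * (p * q * r)
    - c * r ^+ 2 - a * p ^+ 2 - b * q ^+ 2); last by ring.
  by apply: h => //; lra.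
have [ac|/ltW ca] := lerP a c.
  have := @seeber_sorted R b a c q p r; rewrite (_ : b * a * c = a * b * c); last by ring.
  rewrite (_ : q * p * r = p * q * r); last by ring.
  move=> h.
  rewrite [X in 2 * X](_ : _ = a * b * c + 2 * (p * q * r)
    - b * q ^+ 2 - a * p ^+ 2 - c * r ^+ 2); last by ring.
  by apply: h => //; lra.
have [bc|/ltW cb] := lerP b c.
  have := @seeber_sorted R b c a q r p; rewrite (_ : b * c * a = a * b * c); last by ring.
  rewrite (_ : q * r * p = p * q * r); last by ring.
  move=> h.
  rewrite [X in 2 * X](_ : _ = a * b * c + 2 * (p * q * r)
    - b * q ^+ 2 - c * r ^+ 2 - a * p ^+ 2); last by ring.
  by apply: h => //; lra.
have := @seeber_sorted R c b a r q p; rewrite (_ : c * b * a = a * b * c); last by ring.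
rewrite (_ : r * q * p = p * q * r); last by ring.
move=> h.
rewrite [X in 2 * X](_ : _ = a * b * c + 2 * (p * q * r)
    - c * r ^+ 2 - b * q ^+ 2 - a * p ^+ 2); last by ring.
by apply: h => //; lra.
Qed.

Lemma det3 (R : comPzRingType) (A : 'M[R]_3) :
  let a i j := A (inord i) (inord j) in
  \det A = a 0 0 * (a 1 1 * a 2 2 - a 1 2 * a 2 1)
         - a 0 1 * (a 1 0 * a 2 2 - a 1 2 * a 2 0)
         + a 0 2 * (a 1 0 * a 2 1 - a 1 1 * a 2 0) :> R.
Proof.
move=> a; rewrite (expand_det_row _ 0) !big_ord_recl big_ord0 /cofactor.
do !rewrite (expand_det_row _ 0) !big_ord_recl big_ord0 /cofactor !det_mx11.
rewrite !mxE /=.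
have Aa i j : A i j = a i j by rewrite /a !inord_val.
move: a Aa => a Aa.
rewrite !Aa /= /bump /= -[(-1) ^+ (0 + _)]signr_odd /=.
ring.
Qed.

Lemma dotC (R : realType) (n : nat) (u v : 'rV[R]_n) : dot u v = dot v u.
Proof. by apply: eq_bigr => i _; rewrite mulrC. Qed.

Lemma dotDl (R : realType) (n : nat) (u v w : 'rV[R]_n) :
  dot (u + v) w = dot u w + dot v w.
Proof. by rewrite -big_split; apply: eq_bigr => i _; rewrite mxE mulrDl. Qed.

Lemma dotDr (R : realType) (n : nat) (u v w : 'rV[R]_n) :
  dot u (v + w) = dot u v + dot u w.
Proof. by rewrite dotC dotDl !(dotC u). Qed.

Lemma dotZl (R : realType) (n : nat) (a : R) (u v : 'rV[R]_n) :
  dot (a *: u) v = a * dot u v.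
Proof. by rewrite /dot mulr_sumr; apply: eq_bigr => i _; rewrite mxE mulrA. Qed.

Lemma dotZr (R : realType) (n : nat) (a : R) (u v : 'rV[R]_n) :
  dot u (a *: v) = a * dot u v.
Proof. by rewrite dotC dotZl dotC. Qed.

Lemma dot_eq0 (R : realType) (n : nat) (v : 'rV[R]_n) : (dot v v == 0) = (v == 0).
Proof.
apply/eqP/eqP => [v0|->]; last by rewrite /dot big1 // => i _; rewrite mxE mul0r.
apply/rowP => i; rewrite mxE; apply/eqP; rewrite -sqrf_eq0 expr2.
by move/psumr_eq0P : v0 => -> // j _; rewrite -expr2 sqr_ge0.
Qed.

(** A trace-minimal basis has the same Gram determinant and satisfies Seeber's inequalities. [A] is
    rectangular because Mordell's step applies this to a rank 3 section of a lattice in dimension 4;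
    bounding only members of bases, through unimodular [U], avoids completing primitive vectors to
    bases. *)
Lemma hermite3 (R : realType) (n : nat) (A : 'M[R]_(3, n)) (m : R) :
  0 < m -> A *m A^T \in unitmx ->
  (forall U : 'M[int]_3, U \in unitmx -> forall i,
     m <= dot (row i (intmx U *m A)) (row i (intmx U *m A))) ->
  m ^+ 3 <= 2 * \det (A *m A^T).
Proof.
move=> m0 uG mmin.
have [U uU minU] := trace_minimal_basis uG.
pose W := intmx U *m A.
have -> : \det (A *m A^T) = \det (W *m W^T).
  rewrite /W trmx_mul mulmxA -(mulmxA _ A) !det_mulmx det_tr mulrAC -expr2.
  by rewrite -real_normK ?num_real // norm_det_intmx // expr1n mul1r.
pose w i : 'rV[R]_n := row (inord i) W.
pose g i j := dot (w i) (w j).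
have gC i j : g i j = g j i by rewrite /g dotC.
have gE i j : (W *m W^T) (inord i) (inord j) = g i j by rewrite dot_gram.
have gm i : m <= g i i by exact: mmin.
have min3 (i j k : 'I_3) (s t : int) : j != i -> k != i -> j != k ->
    0 <= 2 * (s%:~R * g i j + t%:~R * g i k)
         + s%:~R ^+ 2 * g j j + t%:~R ^+ 2 * g k k + 2 * (s%:~R * t%:~R) * g j k.
  move=> ji ki jk.
  have := trace_minimal_row uU minU (i := i)
    (s := s *: delta_mx 0 j + t *: delta_mx 0 k) _ (erefl W).
  have -> : (s *: delta_mx 0 j + t *: delta_mx 0 k : 'rV[int]_3) 0 i = 0.
    by rewrite !mxE eqxx /= eq_sym (negbTE ji) eq_sym (negbTE ki) !mulr0 addr0.
  move=> /(_ erefl).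
  have -> : intmx (s *: delta_mx 0 j + t *: delta_mx 0 k) *m W =
      s%:~R *: w j + t%:~R *: w k.
    rewrite /w !inord_val (map_mxD intr) mulmxDl.
    by congr (_ + _); rewrite rowE scalemxAl; congr (_ *m _);
      apply/matrixP => a b; rewrite !mxE; case: (_ && _); rewrite ?(mulr1, mulr0).
  rewrite -subr_ge0 !(dotDl, dotDr, dotZl, dotZr).
  move/le_trans; apply; rewrite /g /w !inord_val.
  by rewrite (dotC (row j W) (row i W)) (dotC (row k W) (row i W)) (dotC (row k W) (row j W)); lra.
have d3 := det3 (W *m W^T); rewrite /= !gE in d3; rewrite {}d3.
rewrite (gC 1 0)%N (gC 2 0)%N (gC 2 1)%N.
have := @seeber R m (g 0 0)%N (g 1 1)%N (g 2 2)%N (g 1 2)%N (g 0 2)%N (g 0 1)%N m0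
  (gm _) (gm _) (gm _).
move=> h; apply: le_trans (h _ _) _; last by lra.
- move=> s hs.
  have [s' s'E ss'] : exists2 s' : int, s = s'%:~R & s' ^+ 2 = 1.
    by case: hs => ->; [exists 1|exists (-1)].
  have ss : s ^+ 2 = 1 by rewrite s'E -rmorphXn /= ss'.
  have h01 := min3 0 1 2%:R s' 0 isT isT isT.
  have h02 := min3 0 2%:R 1 s' 0 isT isT isT.
  have h10 := min3 1 0 2%:R s' 0 isT isT isT.
  have h12 := min3 1 2%:R 0 s' 0 isT isT isT.
  have h20 := min3 2%:R 0 1 s' 0 isT isT isT.
  have h21 := min3 2%:R 1 0 s' 0 isT isT isT.
  rewrite -s'E ss /= in h01 h02 h10 h12 h20 h21.
  rewrite (gC 1 0)%N in h10; rewrite (gC 2 0)%N in h20; rewrite (gC 2 1)%N in h21.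
  by split; last split; lra.
move=> s t hs ht w'; rewrite /w'.
have [s' s'E ss'] : exists2 s' : int, s = s'%:~R & s' ^+ 2 = 1.
  by case: hs => ->; [exists 1|exists (-1)].
have ss : s ^+ 2 = 1 by rewrite s'E -rmorphXn /= ss'.
have [t' t'E tt'] : exists2 t' : int, t = t'%:~R & t' ^+ 2 = 1.
  by case: ht => ->; [exists 1|exists (-1)].
have tt : t ^+ 2 = 1 by rewrite t'E -rmorphXn /= tt'.
(* The multipliers are chosen so that, as [s ^+ 2 = t ^+ 2 = 1], the cross terms of all three
   inequalities become the same form [w']. *)
have h01 := min3 0 1 2%:R (s' * t') t' isT isT isT.
have h10 := min3 1 0 2%:R (s' * t') s' isT isT isT.
have h20 := min3 2%:R 0 1 t' s' isT isT isT.
rewrite ?intrM -s'E -t'E ?exprMn ss tt /= in h01 h10 h20.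
rewrite (gC 1 0)%N in h10; rewrite (gC 2 0)%N (gC 2 1)%N in h20.
have stt : s * t * t = s by rewrite -mulrA -expr2 tt mulr1.
have sts : s * t * s = t by rewrite mulrAC -expr2 ss mul1r.
rewrite stt in h01; rewrite sts in h10.
by split; lra.
Qed.

(** * Mordell's inequality and the Hermite constant in rank 4 *)

Lemma invmx_gram (R : realType) (n : nat) (A : 'M[R]_n) : A \in unitmx ->
  invmx (A *m A^T) = (invmx A)^T *m invmx A.
Proof.
move=> uA; have uAT : A^T \in unitmx by rewrite unitmx_tr.
have uG : A *m A^T \in unitmx by rewrite unitmx_mul uA.
apply: (can_inj (mulKmx uG)); rewrite mulmxV // mulmxA -(mulmxA A).
by rewrite trmx_inv mulmxV // mulmx1 mulmxV.
Qed.

(* Mordell: the vectors of a lattice orthogonal to a primitive dual vector d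
   form a lattice of rank 3 whose Gram determinant is det^2 |d|^2. *)
Lemma mordell_section (R : realType) (A : 'M[R]_4) (m : R) :
  0 < m -> A \in unitmx ->
  (forall U : 'M[int]_4, U \in unitmx -> forall i,
     m <= dot (row i (intmx U *m A)) (row i (intmx U *m A))) ->
  m ^+ 3 <= 2 * (\det A ^+ 2 * dot (row 0 (invmx A)^T) (row 0 (invmx A)^T)).
Proof.
move=> m0 uA mmin.
have uG : A *m A^T \in unitmx by rewrite unitmx_mul uA unitmx_tr.
have dA0 : \det (A *m A^T) != 0 by move: uG; rewrite unitmxE unitfE.
pose A3 : 'M[R]_(3, 4) := row' 0 A.
(* The Gram determinant of the section is a diagonal cofactor of [A *m A^T], hence the determinant
   times a diagonal entry of the inverse Gram matrix, which is the Gram matrix of the dual basis. *)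
have dA3 : \det (A3 *m A3^T) =
    \det A ^+ 2 * dot (row 0 (invmx A)^T) (row 0 (invmx A)^T).
  rewrite -dot_gram trmxK -invmx_gram // /invmx uG !mxE /cofactor expr0 mul1r.
  have <- : \det (A *m A^T) = \det A ^+ 2 by rewrite det_mulmx det_tr expr2.
  rewrite mulrA divff // mul1r.
  by congr (\det _); apply/matrixP => i j; rewrite !mxE; apply: eq_bigr => k _; rewrite !mxE.
rewrite -dA3; apply: hermite3 => //.
  rewrite unitmxE unitfE dA3 mulf_neq0 ?expf_neq0 -?unitfE -?unitmxE //.
  rewrite unitfE dot_eq0; apply/eqP => d0.
  have := congr1 (fun B => (col 0 B) 0 0) (mulmxV uA).
  rewrite colE -mulmxA -colE -[col 0 (invmx A)]trmxK tr_col d0.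
  by rewrite trmx0 mulmx0 !mxE => /eqP; rewrite eq_sym oner_eq0.
move=> U uU i.
have A3E : A3 = dsubmx (A : 'M[R]_(1 + 3, 4)).
  by apply/matrixP => a b; rewrite !mxE; congr (A _ _); apply/val_inj.
(* A basis of the section is completed by the first row of [A] to a basis of the whole lattice, so
   its vectors inherit the bound [m]. *)
pose V : 'M[int]_(1 + 3) := block_mx 1%:M 0 0 U.
have uV : V \in unitmx by rewrite unitmxE det_ublock det1 mul1r -unitmxE.
suff -> : row i (intmx U *m A3) = row (rshift 1 i) (intmx V *m A) by exact: mmin.
rewrite /V (map_block_mx intr) -{1}(vsubmxK (A : 'M[R]_(1 + 3, 4))) mul_block_col.
by rewrite rowKd -A3E (map_mx0 intr) mul0mx add0r.
Qed.

(** Any member of a dual basis can be brought to the first place by a permutation. A change [U] of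
    the dual basis corresponds to the contragredient change [V] of the basis, which preserves the
    squared determinant. *)
Lemma mordell (R : realType) (A : 'M[R]_4) (m : R) :
  0 < m -> A \in unitmx ->
  (forall U : 'M[int]_4, U \in unitmx -> forall i,
     m <= dot (row i (intmx U *m A)) (row i (intmx U *m A))) ->
  forall U : 'M[int]_4, U \in unitmx -> forall i,
  m ^+ 3 <= 2 * (\det A ^+ 2 * dot (row i (intmx U *m (invmx A)^T))
                                   (row i (intmx U *m (invmx A)^T))).
Proof.
move=> m0 uA mmin.
suff h0 (U : 'M[int]_4) : U \in unitmx -> m ^+ 3 <= 2 * (\det A ^+ 2 *
    dot (row 0 (intmx U *m (invmx A)^T)) (row 0 (intmx U *m (invmx A)^T))).
  move=> U uU i.
  have -> : row i (intmx U *m (invmx A)^T) =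
      row 0 (intmx (perm_mx (tperm 0 i) *m U) *m (invmx A)^T).
    rewrite intmx_mul -mulmxA (map_perm_mx intr) -row_permE.
    by apply/rowP => k; rewrite !mxE tpermL.
  by apply: h0; rewrite unitmx_mul unitmx_perm.
move=> uU; pose V : 'M[int]_4 := (invmx U)^T.
have uV : V \in unitmx by rewrite unitmx_tr unitmx_inv.
have uVR := @intmx_unit R _ _ uV.
have -> : intmx U *m (invmx A)^T = (invmx (intmx V *m A))^T.
  apply: (canRL (@trmxK _ _ _)); rewrite trmx_mul trmxK.
  apply: (can_inj (mulKmx (_ : intmx V *m A \in unitmx))).
    by rewrite unitmx_mul uVR.
  rewrite mulmxV ?unitmx_mul ?uVR // -mulmxA (mulmxA A) mulmxV // mul1mx.
  by rewrite (map_trmx intr) -intmx_mul -trmx_mul mulmxV // trmx1 (map_mx1 intr).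
have -> : \det A ^+ 2 = \det (intmx V *m A) ^+ 2.
  rewrite det_mulmx exprMn -[X in _ = X * _]real_normK ?num_real //.
  by rewrite norm_det_intmx // expr1n mul1r.
apply: mordell_section => //; first by rewrite unitmx_mul uVR.
move=> W uW i; rewrite mulmxA -intmx_mul; apply: mmin.
by rewrite unitmx_mul uW.
Qed.

(** With [M] and [M'] the infima of square norms over members of bases of the lattice and of its
    dual, and [d] the squared determinant, Mordell's inequality in both directions gives
    [M^3 <= 2 d M'] and [M'^3 <= 2 M / d]. Eliminating [M'] yields [M^9 <= 16 d^2 M]. *)
Lemma hermite4 (R : realType) (A : 'M[R]_4) (m : R) :
  0 <= m -> A \in unitmx ->
  (forall U : 'M[int]_4, U \in unitmx -> forall i,
     m <= dot (row i (intmx U *m A)) (row i (intmx U *m A))) ->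
  m ^+ 4 <= 4 * \det A ^+ 2.
Proof.
move=> m0 uA mmin.
pose E (B : 'M[R]_4) := [set x | exists U : 'M[int]_4, U \in unitmx /\
   exists i, x = dot (row i (intmx U *m B)) (row i (intmx U *m B))].
have E0 B : E B !=set0 by exists (dot (row 0 (intmx 1%:M *m B)) (row 0 (intmx 1%:M *m B)));
  exists 1%:M; split; [rewrite unitmx1|exists 0].
have Elb B : lbound (E B) 0 by move=> x [U [_ [i ->]]]; exact: dot_ge0.
have Einf B x : E B x -> inf (E B) <= x by move=> Ex; apply: ge_inf => //; exists 0.
pose A' := (invmx A)^T.
have uA' : A' \in unitmx by rewrite unitmx_tr unitmx_inv.
have A'A : (invmx A')^T = A by rewrite /A' trmx_inv trmxK invmxK.
pose M := inf (E A); pose M' := inf (E A').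
have mM : m <= M by apply: lb_le_inf => // x [U [uU [i ->]]]; exact: mmin.
have M'0 : 0 <= M' by exact: lb_le_inf.
have [->|mn0] := eqVneq m 0; first by rewrite expr0n /= mulr_ge0 // sqr_ge0.
have mp : 0 < m by rewrite lt_def mn0.
have Mp : 0 < M by exact: lt_le_trans mM.
set d := \det A ^+ 2.
have dp : 0 < d.
  by rewrite /d lt_def sqr_ge0 andbT expf_eq0 /= -unitfE -unitmxE.
have dA' : \det A' ^+ 2 = d^-1 by rewrite det_tr det_inv exprVn.
have d2 : 0 < 2 * d by apply: mulr_gt0.
have d2' : 0 < 2 * d^-1 by apply: mulr_gt0; rewrite ?invr_gt0.
have step1 : M ^+ 3 <= 2 * (d * M').
  rewrite mulrA -(ler_pdivrMl _ _ d2); apply: lb_le_inf => // x [U [uU [i ->]]].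
  rewrite (ler_pdivrMl _ _ d2) -mulrA; apply: mordell => // V uV j.
  by apply: Einf; exists V; split => //; exists j.
have M'p : 0 < M'.
  rewrite lt_def M'0 andbT; apply: contraTneq step1 => ->.
  by rewrite !mulr0 -ltNge exprn_gt0.
have step2 : M' ^+ 3 <= 2 * (d^-1 * M).
  rewrite mulrA -(ler_pdivrMl _ _ d2'); apply: lb_le_inf => // x [U [uU [i ->]]].
  rewrite (ler_pdivrMl _ _ d2') -mulrA.
  have hM' (V : 'M[int]_4) : V \in unitmx -> forall j,
      M' <= dot (row j (intmx V *m A')) (row j (intmx V *m A')).
    by move=> uV j; apply: Einf; exists V; split => //; exists j.
  by have := @mordell R A' M' M'p uA' hM' U uU i; rewrite dA' A'A.
move: d dp d2 d2' dA' step1 step2 => d dp d2 d2' dA' step1 step2.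
have M8 : (M ^+ 4) ^+ 2 <= (4 * d) ^+ 2.
  have h1 : (M ^+ 3) ^+ 3 <= (2 * (d * M')) ^+ 3.
    by rewrite lerXn2r ?nnegrE ?exprn_ge0 ?mulr_ge0 // ltW.
  have h2 : 8 * d ^+ 3 * M' ^+ 3 <= 8 * d ^+ 3 * (2 * (d^-1 * M)).
    by rewrite ler_pM2l // mulr_gt0 // exprn_gt0.
  rewrite -(ler_pM2r Mp).
  apply: le_trans (_ : (M ^+ 3) ^+ 3 <= _); first by rewrite -!exprM -exprSr.
  apply: le_trans h1 _; apply: le_trans (_ : 8 * d ^+ 3 * M' ^+ 3 <= _).
    by rewrite !exprMn; lra.
  apply: le_trans h2 _; rewrite (_ : _ * _ = (4 * d) ^+ 2 * M) //.
  by field; rewrite gt_eqF.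
have M4 : M ^+ 4 <= 4 * d.
  by move: M8; rewrite ler_sqr // nnegrE ?exprn_ge0 ?mulr_ge0 // ltW.
by apply: le_trans M4; rewrite lerXn2r // nnegrE // ltW.
Qed.

(** * Waves and immersions by waves *)

Lemma is_derive_line (R : realType) (n : nat) (f : 'rV[R]_n -> R)
    (x v : 'rV[R]_n) (t d : R) :
  is_derive t 1 (fun h : R => f (x + h *: v)) d <-> is_derive (x + t *: v) v f d.
Proof.
have E : (fun h : R => h^-1 *: (((fun h => f (x + h *: v)) \o shift t) (h *: 1)
                                - f (x + t *: v))) =
    (fun h => h^-1 *: ((f \o shift (x + t *: v)) (h *: v) - f (x + t *: v))).
  apply/funext => h /=; congr (_ *: (f _ - _)).
  by rewrite [h *: 1]mulr1 scalerDl addrCA.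
by split=> -[]; rewrite /derivable /derive /= => d1 d2; apply: DeriveDef;
  rewrite /derivable /derive /= ?E // -E.
Qed.

Lemma continuous_sumr (R : realType) (n : nat) (T : topologicalType)
    (F : 'I_n -> T -> R) :
  (forall i, continuous (F i)) -> continuous (fun x => \sum_i F i x).
Proof.
by move=> cF; apply: continuous_big => // x; exact: add_continuous.
Qed.

Section Waves.
Context {R : realType} {n : nat}.
Implicit Types (a p : R) (xi x v : 'rV[R]_n).

(** The phase closes the family under differentiation: a derivative rescales the amplitude and
    advances the phase by [pi / 2], so sines need no separate treatment. *)
Definition wave a xi p : 'rV[R]_n -> R := fun x => a * cos (dot xi x + p).

Lemma is_derive_wave a xi p x v :
  is_derive x v (wave a xi p) (wave (a * dot xi v) xi (p + pi / 2) x).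
Proof.
have -> : x = x + 0 *: v by rewrite scale0r addr0.
apply/is_derive_line.
have -> : (fun h => wave a xi p (x + h *: v)) =
    (fun h : R => a * cos (h * dot xi v + (dot xi x + p))).
  by apply/funext => h; rewrite /wave dotDr dotZr addrCA addrA.
rewrite /wave scale0r addr0 addrA cosDpihalf.
apply: is_derive_eq.
rewrite /= !scaler0 ?mul0r ?add0r ?addr0 ?mulr1 /GRing.scale /=; ring.
Qed.

Lemma continuous_dot xi : continuous (fun x => dot xi x).
Proof.
apply: continuous_sumr => i x; exact: cvgMl_tmp (@coord_continuous R 1 n 0 i x).
Qed.

Lemma continuous_wave a xi p : continuous (wave a xi p).
Proof.
move=> x; have c1 : (fun y => dot xi y + p) y @[y --> x] --> dot xi x + p.
  exact: cvgD (@continuous_dot xi x) (cvg_cst p).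
have c2 : cos (dot xi y + p) @[y --> x] --> cos (dot xi x + p).
  by apply: (cvg_comp _ _ c1); exact: continuous_cos.
exact: (cvgMl_tmp c2).
Qed.

Lemma partial_wave a xi p i :
  partial i (wave a xi p) = wave (a * xi 0 i) xi (p + pi / 2).
Proof.
apply/funext => x; rewrite /partial (derive_val (is_derive := is_derive_wave _ _ _ _ _)).
congr (wave (a * _) _ _ _); rewrite /dot (bigD1 i) //= !mxE !eqxx mulr1 big1 ?addr0 // => j ji.
by rewrite mxE (negbTE ji) andbF mulr0.
Qed.

Lemma smooth_wave a xi p : smooth (wave a xi p).
Proof.
move=> k; elim: k a p => [|k IH] a p /=; split => //; try exact: continuous_wave.
move=> i; split=> [x|]; first exact: (ex_derive (is_derive := is_derive_wave _ _ _ _ _)).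
by rewrite partial_wave.
Qed.

Lemma laplacian_wave a xi p x :
  - laplacian (wave a xi p) x = dot xi xi * wave a xi p x.
Proof.
rewrite /laplacian /dot mulr_suml -sumrN; apply: eq_bigr => i _.
rewrite !partial_wave /wave addrA cosDpihalf addrA sinDpihalf; ring.
Qed.

End Waves.

Lemma cosDint (R : realType) (t z : R) :
  z \is a Num.int -> cos (t + 2 * pi * z) = cos t.
Proof.
have nat_case (s : R) (k : nat) : cos (s + 2 * pi * k%:R) = cos s.
  by rewrite mulr_natr mulr_natl (periodicn (@cosD2pi R)).
move=> /intrP[[k|k] ->]; first exact: nat_case.
by rewrite NegzE mulrNz mulrN -(nat_case (t - _) k.+1) subrK.
Qed.

Lemma dot_suml (R : realType) (n : nat) (I : finType) (F : I -> 'rV[R]_n) v :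
  dot (\sum_i F i) v = \sum_i dot (F i) v.
Proof.
rewrite /dot exchange_big /=; apply: eq_bigr => k _.
by rewrite summxE mulr_suml.
Qed.

Section Eigenfunctions.
Context {R : realType} {n : nat}.
Implicit Types (L : set 'rV[R]_n) (xi x : 'rV[R]_n).

Lemma eigenfunction_wave L (a p : R) xi :
  a != 0 -> xi != 0 -> dual_lattice L xi ->
  eigenfunction L (4 * pi ^+ 2 * dot xi xi) (wave a ((2 * pi) *: xi) p).
Proof.
move=> a0 xi0 xiL; split; first exact: smooth_wave.
- move=> v Lv x; rewrite /wave dotDr dotZl !dotZl addrAC cosDint //; exact: xiL.
- have d0 : dot ((2 * pi) *: xi) ((2 * pi) *: xi) != 0.
    by rewrite dot_eq0 scaler_eq0 negb_or xi0 andbT mulf_neq0 ?pnatr_eq0 // gt_eqF // pi_gt0.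
  move: ((2 * pi) *: xi) d0 => w d0; exists ((- p / dot w w) *: w).
  by rewrite /wave dotZr divfK // addNr cos0 mulr1.
- by move=> x; rewrite laplacian_wave dotZl dotZr; congr (_ * _); ring.
Qed.

Lemma lambda1_le L xi :
  dual_lattice L xi -> xi != 0 -> lambda1 L <= 4 * pi ^+ 2 * dot xi xi.
Proof.
move=> xiL xi0; apply: ge_inf; first by exists 0 => l [/ltW].
split.
  rewrite mulr_gt0 ?mulr_gt0 ?exprn_gt0 ?pi_gt0 //.
  by rewrite lt_def dot_eq0 xi0 dot_ge0.
by exists (wave 1 ((2 * pi) *: xi) 0); apply: eigenfunction_wave => //; rewrite oner_neq0.
Qed.

Lemma lambda1_ge0 L : 0 <= lambda1 L.
Proof.
rewrite /lambda1; have [->|/set0P ne0] := eqVneq [set l | 0 < l /\ laplace_eigenvalue L l] set0.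
  (* The infimum of the empty set is [0] by convention. *)
  by rewrite inf0.
by apply: lb_le_inf => // l [/ltW].
Qed.

(** A lower bound of a set bounds its infimum only when the set is nonempty; the wave of [xi]
    supplies an element. *)
Lemma lambda1_ge L (m : R) xi : dual_lattice L xi -> xi != 0 ->
  (forall l, 0 < l -> laplace_eigenvalue L l -> m <= l) -> m <= lambda1 L.
Proof.
move=> xiL xi0 mL; apply: lb_le_inf => [|l [l0 Ll]]; last exact: mL.
exists (4 * pi ^+ 2 * dot xi xi); split.
  rewrite mulr_gt0 ?mulr_gt0 ?exprn_gt0 ?pi_gt0 //.
  by rewrite lt_def dot_eq0 xi0 dot_ge0.
by exists (wave 1 ((2 * pi) *: xi) 0); apply: eigenfunction_wave => //; rewrite oner_neq0.
Qed.

End Eigenfunctions.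

Section WaveImmersion.
Context {R : realType} {n : nat} {T : finType}.
Variables (L : set 'rV[R]_n) (xi : T -> 'rV[R]_n) (q : R) (t0 : T).
Hypothesis xi_dual : forall t, dual_lattice L (xi t).
Hypothesis xi_neq0 : forall t, xi t != 0.
Hypothesis xi_norm : forall t, dot (xi t) (xi t) = q.
Hypothesis xi_lambda1 : lambda1 L = 4 * pi ^+ 2 * q.
Hypothesis xi_tight : forall i j,
  4 * pi ^+ 2 * \sum_t xi t 0 i * xi t 0 j = #|T|%:R * (i == j)%:R.

Local Notation a := (Num.sqrt (#|T|%:R : R))^-1.
Local Notation freq t := ((2 * pi) *: xi t).
Local Notation phase b := (if b then 0 else pi / 2 : R).

(** Up to signs these are the real and imaginary parts (phases [0] and [pi / 2]) of the characters
    [exp (2 pi i <xi t, x>)], with the amplitude that puts the image on the unit sphere. *)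
Definition wave_immersion (x : 'rV[R]_n) : 'rV[R]_(#|{: T * bool}|) :=
  \row_k wave a (freq (enum_val k).1) (phase (enum_val k).2) x.

Let u := wave_immersion.

Lemma sum_waves (F : T -> bool -> R) :
  \sum_(k < #|{: T * bool}|) F (enum_val k).1 (enum_val k).2 =
  \sum_t (F t true + F t false).
Proof.
transitivity (\sum_(tb : T * bool) F tb.1 tb.2).
  by rewrite [RHS](reindex _ (onW_bij _ (enum_val_bij _))).
rewrite -(pair_bigA _ (fun t b => F t b)) /=.
by apply: eq_bigr => t _; rewrite big_bool.
Qed.

Lemma amplitude_neq0 : a != 0.
Proof.
rewrite invr_eq0 sqrtr_eq0 -ltNge ltr0n; apply/card_gt0P; by exists t0.
Qed.

Lemma amplitude_sqr_card : a ^+ 2 * #|T|%:R = 1.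
Proof.
rewrite exprVn sqr_sqrtr ?ler0n // mulVf // pnatr_eq0 -lt0n.
by apply/card_gt0P; exists t0.
Qed.

Lemma coordinate_wave k : coordinate u k =
  wave a (freq (enum_val k).1) (phase (enum_val k).2).
Proof. by apply/funext => x; rewrite /coordinate mxE. Qed.

Lemma partial_map_wave i x : partial_map i u x =
  \row_k wave (a * freq (enum_val k).1 0 i) (freq (enum_val k).1)
           (phase (enum_val k).2 + pi / 2) x.
Proof. by apply/rowP => k; rewrite !mxE coordinate_wave partial_wave mxE. Qed.

Lemma dot_wave_immersion x : dot (u x) (u x) = 1.
Proof.
rewrite -amplitude_sqr_card /dot.
under eq_bigr do rewrite !mxE.
rewrite (sum_waves (fun t b => wave a (freq t) (phase b) x * wave a (freq t) (phase b) x)).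
rewrite (eq_bigr (fun=> a ^+ 2)) ?sumr_const ?mulr_natr //.
move=> t _; rewrite /wave addr0 cosDpihalf -[RHS]mulr1 -[X in _ = _ * X](cos2Dsin2 (dot (freq t) x)); ring.
Qed.

Lemma dot_wave_immersion_partial i x : dot (u x) (partial_map i u x) = 0.
Proof.
rewrite partial_map_wave /dot; under eq_bigr do rewrite !mxE.
rewrite (sum_waves (fun t b => wave a (freq t) (phase b) x *
  wave (a * (2 * pi * xi t 0 i)) (freq t) (phase b + pi / 2) x)).
apply: big1 => t _; rewrite /wave !addrA !addr0 !cosDpihalf sinDpihalf; ring.
Qed.

(** Each cosine and sine pair contributes a constant, since [cos^2 + sin^2 = 1]; what is left is the
    tight frame identity [xi_tight]. *)
Lemma first_form_wave_immersion x : first_form u x = 1%:M.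
Proof.
apply/matrixP => i j; rewrite !mxE !partial_map_wave /dot.
under eq_bigr do rewrite !mxE.
rewrite (sum_waves (fun t b => wave (a * (2 * pi * xi t 0 i)) (freq t) (phase b + pi / 2) x *
  wave (a * (2 * pi * xi t 0 j)) (freq t) (phase b + pi / 2) x)).
rewrite (eq_bigr (fun t => a ^+ 2 * (4 * pi ^+ 2 * (xi t 0 i * xi t 0 j)))); last first.
  move=> t _; rewrite /wave !addrA !addr0 !cosDpihalf sinDpihalf.
  rewrite -[RHS]mulr1 -[X in _ = _ * X](cos2Dsin2 (dot (freq t) x)); ring.
by rewrite -mulr_sumr -mulr_sumr xi_tight mulrA amplitude_sqr_card mul1r.
Qed.

Lemma laplacian_wave_immersion x : \sum_i partial_map i (partial_map i u) x =
  - (4 * pi ^+ 2 * q) *: u x.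
Proof.
apply/rowP => k; rewrite summxE !mxE.
have := laplacian_wave a (freq (enum_val k).1) (phase (enum_val k).2) x.
rewrite dotZl dotZr xi_norm => /(congr1 -%R); rewrite opprK => lap.
transitivity (laplacian (wave a (freq (enum_val k).1) (phase (enum_val k).2)) x).
  apply: eq_bigr => i _; rewrite mxE; congr (partial _ _ _).
  by apply/funext => y; rewrite /coordinate mxE coordinate_wave.
rewrite lap -mulNr; congr (_ * _); ring.
Qed.

Lemma normal_part_wave_immersion x w : normal_part u x w =
  w - dot w (u x) *: u x - \sum_i dot w (partial_map i u x) *: partial_map i u x.
Proof.
rewrite /normal_part first_form_wave_immersion invmx1; congr (_ - _).
apply: eq_bigr => i _; rewrite (bigD1 i) //= mxE eqxx mul1r big1 ?addr0 // => j ji.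
by rewrite mxE eq_sym (negbTE ji) mul0r scale0r.
Qed.

(** As the induced metric is Euclidean, the mean curvature is the normal part of the Laplacian of
    [u]. That Laplacian is a multiple of [u], which is orthogonal to the tangent directions and is
    removed by the radial projection. *)
Lemma mean_curvature_wave_immersion x : mean_curvature u x = 0.
Proof.
rewrite /mean_curvature first_form_wave_immersion invmx1.
transitivity (\sum_i normal_part u x (partial_map i (partial_map i u) x)).
  apply: eq_bigr => i _; rewrite (bigD1 i) //= mxE eqxx scale1r big1 ?addr0 // => j ji.
  by rewrite mxE eq_sym (negbTE ji) scale0r.
under eq_bigr do rewrite normal_part_wave_immersion.
rewrite !sumrB laplacian_wave_immersion.
rewrite exchange_big /= [X in _ - X]big1 => [|j _]; last first.
  rewrite -scaler_suml -dot_suml laplacian_wave_immersion dotZl dot_wave_immersion_partial mulr0 scale0r //.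
by rewrite subr0 -scaler_suml -dot_suml laplacian_wave_immersion dotZl dot_wave_immersion mulr1 subrr.
Qed.

Lemma wave_immersion_minimal : lambda1_minimal_immersion L u.
Proof.
have eig k : eigenfunction L (lambda1 L) (coordinate u k).
  by rewrite coordinate_wave xi_lambda1 -(xi_norm (enum_val k).1);
    apply: eigenfunction_wave; rewrite ?amplitude_neq0.
split=> //; first split.
- by move=> v Lv x; apply/rowP => k; have [_ per _ _] := eig k; exact: per.
- by move=> k; have [] := eig k.
- exact: dot_wave_immersion.
- exact: first_form_wave_immersion.
- exact: mean_curvature_wave_immersion.
Qed.

End WaveImmersion.

(** * Directional derivatives of smooth periodic functions *)

Lemma is_derive_cvg (R : realType) (V : normedModType R) (f : V -> R) (x v : V) (d : R) :
  h^-1 * (f (h *: v + x) - f x) @[h --> 0^'] --> d -> is_derive x v f d.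
Proof.
move=> H; apply: DeriveDef; first by apply/cvg_ex; exists d.
exact: cvg_lim H.
Qed.

Lemma mean_value (R : realType) (f f' : R -> R) (a b : R) :
  (forall x : R, is_derive x 1 f (f' x)) ->
  exists2 s, `|s - a| <= `|b - a| & f b - f a = f' s * (b - a).
Proof.
move=> df.
have cf x : {for x, continuous f}.
  by apply: differentiable_continuous; apply/derivable1_diffP; have [] := df x.
have cf' u v : {within `[u, v], continuous f} by exact: continuous_subspaceT.
have [ab|ba] := leP a b.
  have [s /itvP sab E] := MVT_segment ab (fun x _ => df x) (cf' _ _).
  by exists s => //; rewrite !ger0_norm ?subr_ge0 ?sab // lerD2r sab.
have [s /itvP sab E] := MVT_segment (ltW ba) (fun x _ => df x) (cf' _ _).
exists s; last by rewrite -[LHS]opprB E -mulrN opprB.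
by rewrite !ler0_norm ?subr_le0 ?sab ?(ltW ba) // !opprB lerD2l lerN2 sab.
Qed.

Section ClassC.
Context {R : realType} {n : nat}.
Implicit Types (f g : 'rV[R]_n -> R) (x v e : 'rV[R]_n).

(** The increment along [v + c *: e] splits into a step along [v] from [x] and a step along [e] from
    a nearby point. The mean value theorem turns the second step into a value of [g] near [x]. *)
Lemma is_deriveD_dir f g x v e (c d : R) :
  is_derive x v f d -> (forall y, is_derive y e f (g y)) ->
  {for x, continuous g} -> is_derive x (v + c *: e) f (d + c * g x).
Proof.
move=> dv de cg; apply: is_derive_cvg.
have qv : h^-1 * (f (h *: v + x) - f x) @[h --> 0^'] --> d.
  by case: dv => dv <-; exact: dv.
have qe : h^-1 * (f (h *: (v + c *: e) + x) - f (h *: v + x)) @[h --> 0^'] --> c * g x.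
  apply/cvgrPdist_le => eps eps0.
  have eps' : 0 < eps / (`|c| + 1) by rewrite divr_gt0 // ltr_wpDl.
  have /cvgrPdist_le/(_ _ eps')/nbhs_ballP[r /= r0 hr] := cg.
  pose M := `|v| + `|c| * `|e| + 1.
  have M0 : 0 < M by rewrite ltr_wpDl // addr_ge0 // mulr_ge0.
  near=> h.
  have h0 : h != 0 by near: h; exact: nbhs_dnbhs_neq.
  have hM : `|h| * M < r.
    rewrite -ltr_pdivlMr //; near: h; apply: dnbhs0_lt; exact: divr_gt0.
  pose phi (s : R) := f (h *: v + x + s *: e).
  have dphi (s : R) : is_derive s 1 phi (g (h *: v + x + s *: e)) by apply/is_derive_line.
  have [s sh E] := mean_value 0 (h * c) dphi.
  have -> : f (h *: (v + c *: e) + x) - f (h *: v + x) = phi (h * c) - phi 0.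
    by rewrite /phi scale0r addr0 scalerDr scalerA addrAC.
  rewrite E subr0 mulrCA mulKf // mulrC -mulrBl normrM.
  have := hr (h *: v + x + s *: e); rewrite -ball_normE /= => hr'.
  apply: le_trans (_ : eps / (`|c| + 1) * `|c| <= _); last first.
    by rewrite mulrAC ler_pdivrMr ?ltr_wpDl // ler_pM2l // lerDl.
  apply: ler_wpM2r => //; apply: hr'.
  rewrite (_ : x - _ = - (h *: v + s *: e)); last by rewrite addrAC opprD addrCA subrr addr0.
  rewrite normrN; apply: le_lt_trans hM; apply: le_trans (ler_normD _ _) _.
  rewrite !normrZ /M mulrDr mulrDr mulr1 -addrA lerD2l.
  apply: le_trans (_ : `|h| * (`|c| * `|e|) <= _); last by rewrite lerDl.
  by rewrite mulrA ler_wpM2r // -normrM; move: sh; rewrite !subr0.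
rewrite [d + _]addrC; apply: cvg_trans (cvgD qe qv); apply: near_eq_cvg.
by near=> h; rewrite /= -mulrDr addrA subrK.
Unshelve. all: by end_near. Qed.

Lemma class_C_continuous k f : class_C k f -> continuous f.
Proof. by case: k => [|k] []. Qed.

(** The direction [v] is built up one coordinate at a time, each addition using the continuity of
    one partial derivative. *)
Lemma is_derive_class_C f x v : class_C 1 f ->
  is_derive x v f (\sum_i v 0 i * partial i f x).
Proof.
move=> [cf df].
rewrite {1}(row_sum_delta v).
elim: (index_enum _) => [|i r IH]; first by rewrite !big_nil; exact: is_derive0.
rewrite !big_cons [X in is_derive _ X]addrC [X in is_derive _ _ _ X]addrC.
apply: is_deriveD_dir => //.
  by move=> y; apply: derivableP; exact: (df i).1.
by have [_ [c _]] := df i; exact: c.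
Qed.
End ClassC.

(** The mean value theorem replaces Taylor's formula: the remainder and its derivative vanish at
    [0], and the last application is made at [s2] and [- s2] separately, whence the factor [2]. *)
Lemma second_difference1 (R : realType) (g0 g1 g2 g3 : R -> R) (K : R) :
  (forall t : R, is_derive t 1 g0 (g1 t)) ->
  (forall t : R, is_derive t 1 g1 (g2 t)) ->
  (forall t : R, is_derive t 1 g2 (g3 t)) -> (forall t, `|g3 t| <= K) ->
  forall h, `|g0 h + g0 (- h) - 2 * g0 0 - h ^+ 2 * g2 0| <= 2 * K * `|h| ^+ 3.
Proof.
move=> dg0 dg1 dg2 gK h.
have dN (g g' : R -> R) : (forall t : R, is_derive t 1 g (g' t)) ->
    forall t : R, is_derive t 1 (fun t => g (- t)) (- g' (- t)).
  move=> dg t; have := @is_derive1_comp R g (fun t => - t) t (g' (- t)) (-1).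
  by rewrite mulrN1; apply; exact: is_deriveNid.
have dN0 := dN _ _ dg0; have dN1 := dN _ _ dg1.
have d0 (t : R) : is_derive t 1 (fun t => g0 t + g0 (- t) - 2 * g0 0 - t ^+ 2 * g2 0)
    (g1 t - g1 (- t) - 2 * t * g2 0).
  by apply: is_derive_eq; rewrite /GRing.scale /=; ring.
have d1 (t : R) : is_derive t 1 (fun t => g1 t - g1 (- t) - 2 * t * g2 0)
    (g2 t + g2 (- t) - 2 * g2 0).
  by apply: is_derive_eq; rewrite /GRing.scale /=; ring.
have [s1 s1h E1] := mean_value 0 h d0.
have [s2 s2h E2] := mean_value 0 s1 d1.
have [s3 s3h E3] := mean_value 0 s2 dg2.
have [s4 s4h E4] := mean_value 0 (- s2) dg2.
rewrite !(subr0, oppr0) in s1h s2h E1 E2 E3 E4.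
have E : g0 h + g0 (- h) - 2 * g0 0 - h ^+ 2 * g2 0 =
    (g3 s3 - g3 s4) * s2 * s1 * h.
  have -> : g0 h + g0 (- h) - 2 * g0 0 - h ^+ 2 * g2 0 =
     (g1 s1 - g1 (- s1) - 2 * s1 * g2 0) * h by rewrite -E1; ring.
  congr (_ * _).
  have -> : g1 s1 - g1 (- s1) - 2 * s1 * g2 0 =
     (g2 s2 + g2 (- s2) - 2 * g2 0) * s1 by rewrite -E2; ring.
  congr (_ * _).
  have -> : g2 s2 + g2 (- s2) - 2 * g2 0 = (g2 s2 - g2 0) + (g2 (- s2) - g2 0) by ring.
  by rewrite E3 E4; ring.
rewrite E !normrM.
have K0 : 0 <= K by exact: le_trans (gK 0).
have -> : 2 * K * `|h| ^+ 3 = 2 * K * `|h| * `|h| * `|h| by ring.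
rewrite ler_wpM2r // ler_pM // ?mulr_ge0 // ler_pM //; last exact: le_trans s1h.
apply: le_trans (ler_normB _ _) _; have := gK s3; have := gK s4; lra.
Qed.

Section Smooth.
Context {R : realType} {n : nat}.
Implicit Types (f g : 'rV[R]_n -> R) (x v e : 'rV[R]_n).

Lemma class_C_sum k (m : nat) (c : 'I_m -> R) (F : 'I_m -> 'rV[R]_n -> R) :
  (forall j, class_C k (F j)) -> class_C k (fun x => \sum_j c j * F j x).
Proof.
elim: k F => [|k IH] F CF.
  split=> //; apply: continuous_sumr => j x.
  exact: cvgMl_tmp (@class_C_continuous _ _ _ _ (CF j) x).
have isd i x : is_derive x (delta_mx 0 i) (fun x => \sum_j c j * F j x)
    (\sum_j c j * partial i (F j) x).
  have -> : (fun x => \sum_j c j * F j x) = \sum_j (c j \*: F j).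
    by apply/funext => y; rewrite fct_sumE.
  apply: is_derive_sum => j; apply: is_deriveZ; apply: derivableP.
  by have [_ /(_ i)[]] := CF j.
split.
  by apply: continuous_sumr => j x; exact: cvgMl_tmp (@class_C_continuous _ _ _ _ (CF j) x).
move=> i; split=> [x|]; first by have [] := isd i x.
have -> : partial i (fun x => \sum_j c j * F j x) =
    (fun x => \sum_j c j * partial i (F j) x).
  by apply/funext => x; exact: (derive_val (is_derive := isd i x)).
by apply: IH => j; have [_ /(_ i)[]] := CF j.
Qed.

Lemma smooth_deriveE f v x : smooth f ->
  'D_v f x = \sum_i v 0 i * partial i f x.
Proof.
by move=> sf; exact: (derive_val (is_derive := is_derive_class_C x v (sf 1%N))).
Qed.

Lemma smooth_derive_sum f v : smooth f ->
  'D_v f = (fun x => \sum_i v 0 i * partial i f x).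
Proof.
by move=> sf; apply/funext => x; exact: smooth_deriveE.
Qed.

Lemma smooth_partial f i : smooth f -> smooth (partial i f).
Proof. by move=> sf k; have [_ /(_ i)[]] := sf k.+1. Qed.

Lemma smooth_derive f v : smooth f -> smooth ('D_v f).
Proof.
move=> sf k; rewrite smooth_derive_sum //; apply: class_C_sum => i.
exact: smooth_partial.
Qed.

Lemma smooth_is_derive f x v : smooth f -> is_derive x v f ('D_v f x).
Proof.
by move=> sf; apply: derivableP; have [] := is_derive_class_C x v (sf 1%N).
Qed.

Lemma periodic_derive L f v : Defs.periodic L f -> Defs.periodic L ('D_v f).
Proof.
move=> pf w Lw x; rewrite /derive.
suff -> : (fun h : R => h^-1 *: ((f \o shift (x + w)) (h *: v) - f (x + w))) =
  (fun h => h^-1 *: ((f \o shift x) (h *: v) - f x)) by [].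
by apply/funext => h /=; rewrite addrA !(pf w Lw).
Qed.

(** The coefficient of each second partial derivative is an entry of [P^T *m P], so the mixed ones
    drop out. *)
Lemma smooth_laplacian_frame f (P : 'M[R]_n) (c : R) x : smooth f ->
  P^T *m P = c%:M ->
  \sum_i 'D_(row i P) ('D_(row i P) f) x = c * laplacian f x.
Proof.
move=> sf PP.
have E i : 'D_(row i P) ('D_(row i P) f) x =
    \sum_b \sum_a (P i b * P i a) * partial b (partial a f) x.
  rewrite (smooth_deriveE _ _ (smooth_derive (row i P) sf)).
  rewrite (smooth_derive_sum (row i P) sf).
  apply: eq_bigr => b _; rewrite mxE.
  have -> : partial b (fun y => \sum_a row i P 0 a * partial a f y) x =
      \sum_a P i a * partial b (partial a f) x.
    have -> : (fun y => \sum_a row i P 0 a * partial a f y) = \sum_a (P i a \*: partial a f).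
      by apply/funext => y; rewrite fct_sumE; apply: eq_bigr => a _; rewrite mxE.
    apply: derive_val; apply: is_derive_sum => a; apply: is_deriveZ.
    exact: smooth_is_derive (smooth_partial a sf).
  by rewrite mulr_sumr; apply: eq_bigr => a _; rewrite mulrA.
under eq_bigr do rewrite E.
rewrite exchange_big /laplacian mulr_sumr; apply: eq_bigr => b _.
rewrite exchange_big /= (bigD1 b) //= [X in _ + X]big1 ?addr0 => [|a ab].
  rewrite -mulr_suml; congr (_ * _); move/matrixP/(_ b b): PP; rewrite !mxE eqxx mulr1n => <-.
  by apply: eq_bigr => i _; rewrite mxE.
rewrite -mulr_suml; move/matrixP/(_ b a): PP; rewrite !mxE eq_sym (negbTE ab) mulr0n.
by under eq_bigr do rewrite mxE; move=> ->; rewrite mul0r.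
Qed.

(** A lattice translation brings any point to one with coordinates in [[0, 1]] in the frame [P],
    hence into a compact box of half-side [M], where a continuous function attains its maximum. *)
Lemma periodic_bounded L f (P : 'M[R]_n) : continuous f -> Defs.periodic L f ->
  P \in unitmx -> (forall z : 'rV[int]_n, L (intmx z *m P)) ->
  exists2 K, 0 <= K & forall x, `|f x| <= K.
Proof.
move=> cf pf uP LP.
pose M : R := \sum_i \sum_j `|P i j|.
pose A : set 'rV[R]_n := [set y | forall i, `[- M, M]%classic (y 0 i)].
have cA : compact A by apply: (@rV_compact _ _ (fun=> `[(- M), M]%classic)) => i; exact: segment_compact.
have A0 : A !=set0.
  exists 0 => i /=; rewrite mxE in_itv /= oppr_le0 andbb.
  by apply: sumr_ge0 => j _; apply: sumr_ge0.
have cabs : {within A, continuous (fun x => `|f x|)}.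
  by apply: continuous_subspaceT => x; exact: cvg_norm (cf x).
have [y _ ymax] := EVT_max_rV A0 cA cabs.
exists `|f y| => // x.
pose t := x *m invmx P.
pose z : 'rV[int]_n := \row_i Num.floor (t 0 i).
pose r := t - intmx z.
have rE i : 0 <= r 0 i <= 1.
  rewrite !mxE subr_ge0 lerBlDr floor_le_tmp /=.
  by have := floorD1_gt (\sum_(j < n) x 0 j * invmx P j i); rewrite intrD addrC => /ltW.
have xE : x = r *m P + intmx z *m P by rewrite -mulmxDl subrK mulmxKV.
rewrite xE pf //; apply: ymax; rewrite inE => j /=; rewrite in_itv /= -ler_norml.
rewrite mxE; apply: le_trans (ler_norm_sum _ _ _) _; apply: ler_sum => i _.
rewrite normrM; apply: le_trans (_ : `|P i j| <= _).
  by rewrite ler_piMl // ger0_norm; have /andP[] := rE i.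
by rewrite (bigD1 j) //= lerDl sumr_ge0.
Qed.

Lemma second_difference f v (K : R) : smooth f ->
  (forall x, `|'D_v ('D_v ('D_v f)) x| <= K) ->
  forall x h, `|f (x + h *: v) + f (x - h *: v) - 2 * f x
               - h ^+ 2 * 'D_v ('D_v f) x| <= 2 * K * `|h| ^+ 3.
Proof.
move=> sf bK x h.
have dline g (t : R) : smooth g ->
    is_derive t 1 (fun t => g (x + t *: v)) ('D_v g (x + t *: v)).
  by move=> sg; apply/is_derive_line; exact: smooth_is_derive.
have s1 := smooth_derive v sf; have s2 := smooth_derive v s1.
have := @second_difference1 R _ _ _ _ K (fun t => dline _ t sf) (fun t => dline _ t s1)
  (fun t => dline _ t s2) (fun t => bK _) h.
by rewrite /= scaleNr scale0r addr0.
Qed.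

End Smooth.

(** * Discrete Fourier analysis and the lower bound on eigenvalues *)

Lemma le_cos (R : realType) (x y : R) : 0 <= x -> x <= y -> y <= pi -> cos y <= cos x.
Proof.
move=> x0; rewrite le_eqVlt => /orP[/eqP -> //|xy] yp; apply: ltW.
by rewrite ltr_cos // in_itv /= ?x0 ?yp ?(ltW (le_lt_trans x0 xy)) ?(le_trans (ltW xy)).
Qed.

Section DiscreteFourier.
Context {R : realType} {n N' : nat}.
Local Notation N := N'.+2.
Local Notation G := 'rV['I_N]_n.
Implicit Types (k j d : G) (F : G -> R) (t : R).

Local Notation w := (2 * pi / N%:R : R).

(** The representatives in [0 .. N - 1] make this additive only modulo [2 pi]. Additivity is
    therefore stated under [cos], with a free phase [t] that also covers the sine. *)
Definition angle k j : R := w * (\sum_i k 0%R i * j 0%R i)%N%:R.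

Definition unit_step (i : 'I_n) : G := \row_a (if a == i then inord 1 else 0).

Lemma angleC k j : angle k j = angle j k.
Proof. by congr (_ * _%:R); apply: eq_bigr => i _; rewrite mulnC. Qed.

Lemma natN_neq0 : N%:R != 0 :> R. Proof. by rewrite pnatr_eq0. Qed.

Lemma cos_angleDl k k' j t : cos (angle (k + k') j + t) = cos (angle k j + angle k' j + t).
Proof.
have -> : angle k j + angle k' j + t =
    angle (k + k') j + t + 2 * pi * (\sum_i (k 0%R i + k' 0%R i) %/ N * j 0%R i)%N%:R.
  suff : (\sum_i k 0%R i * j 0%R i)%N%:R + (\sum_i k' 0%R i * j 0%R i)%N%:R =
      (\sum_i (k + k')%R 0%R i * j 0%R i)%N%:R
      + N%:R * (\sum_i (k 0%R i + k' 0%R i) %/ N * j 0%R i)%N%:R :> R.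
    by move=> /(congr1 ( *%R w)); rewrite [LHS]mulrDr [RHS]mulrDr /angle => ->; field;
      apply: lt0r_neq0; have := ler0n R N'; lra.
  rewrite -!natrM -!natrD; congr (_%:R).
  rewrite big_distrr -!big_split /=; apply: eq_bigr => i _; rewrite !mxE /=.
  by rewrite -mulnDl [in LHS](divn_eq (k 0%R i + k' 0%R i) N) mulnA -mulnDl addnC [(N * _)%N]mulnC.
by rewrite cosDint // rpred_nat.
Qed.

Lemma cos_angleDr k j j' t : cos (angle k (j + j') + t) = cos (angle k j + angle k j' + t).
Proof. by rewrite !(angleC k) cos_angleDl. Qed.

Lemma angle_unit_step k i : angle k (unit_step i) = w * (k 0%R i : nat)%:R.
Proof.
rewrite /angle (bigD1 i) //= mxE eqxx inordK // muln1 big1 ?addn0 // => a ai.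
by rewrite mxE (negbTE ai) muln0.
Qed.

Lemma cos_lt1 (x : R) : 0 < x < 2 * pi -> cos x < 1.
Proof.
move=> /andP[x0 x2].
have -> : x = (x / 2) *+ 2 by rewrite -mulr_natr divfK // pnatr_eq0.
rewrite cos_mulr2n cos2sin2 mulrnBl.
have : 0 < sin (x / 2) by apply: sin_gt0_pi; apply/andP; split; lra.
move=> s0; have : 0 < sin (x / 2) ^+ 2 by rewrite exprn_gt0.
by lra.
Qed.

(** Orthogonality of characters without complex numbers: translating [k] shows that the sum [T] is
    unchanged when [t] moves by [al], while the addition formula gives
    [T (t + al) + T (t - al) = 2 cos al T t], and [cos al < 1]. *)
Lemma sum_cos_angle d t : d != 0 -> \sum_k cos (angle k d + t) = 0.
Proof.
move=> d0.
have [i di] : exists i, d 0%R i != 0.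
  apply/existsP; apply: contraNT d0; rewrite negb_exists => /forallP h.
  by apply/eqP/rowP => i; rewrite mxE; apply/eqP; have := h i; rewrite negbK.
pose al := angle (unit_step i) d.
pose T t := \sum_k cos (angle k d + t).
have shift s : T (s + al) = T s.
  rewrite /T [RHS](reindex_inj (addIr (unit_step i))) /=; apply: eq_bigr => k _.
  by rewrite cos_angleDl -addrA (addrC s).
have al1 : cos al < 1.
  apply: cos_lt1; rewrite /al angleC angle_unit_step.
  have dp : 0 < (d 0%R i : nat)%:R :> R by rewrite ltr0n lt0n.
  have dN : (d 0%R i : nat)%:R < N%:R :> R by rewrite ltr_nat.
  have p0 : 0 < pi :> R := pi_gt0 R.
  have N0 : 0 < N%:R :> R by rewrite ltr0n.
  rewrite mulr_gt0 ?divr_gt0 ?mulr_gt0 //=.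
  by rewrite mulrAC ltr_pdivrMr // ltr_pM2l // mulr_gt0.
have : T (t + al) + T (t - al) = 2 * cos al * T t.
  rewrite /T -big_split /= mulr_sumr; apply: eq_bigr => k _.
  by rewrite (addrA _ t al) (addrA _ t (- al)) (cosD _ al) (cosB _ al); ring.
rewrite -[T (t - al)]shift subrK shift -/(T t) => h.
have : (1 - cos al) * T t = 0 by lra.
by move/eqP; rewrite mulf_eq0 subr_eq0 gt_eqF //= => /eqP.
Qed.

(** At [t = 0] and [t = pi / 2] these are the real and imaginary parts of the Fourier coefficient
    [sum_j F j exp (- i angle k j)]. *)
Definition coef F k t : R := \sum_j F j * cos (angle k j + t).

Lemma parseval F :
  \sum_k (coef F k 0 ^+ 2 + coef F k (pi / 2) ^+ 2) = #|{: G}|%:R * \sum_j F j ^+ 2.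
Proof.
transitivity (\sum_k \sum_j \sum_j' F j * F j' * cos (angle k (j - j') + 0)).
  apply: eq_bigr => k _; rewrite !expr2 /coef !mulr_suml -big_split /=.
  apply: eq_bigr => j _; rewrite !mulr_sumr -big_split /=; apply: eq_bigr => j' _.
  have -> : cos (angle k (j - j') + 0) = cos (angle k j - angle k j').
    by rewrite -[in RHS](subrK j' j) (cos_angleDr k (j - j') j') addrK addr0.
  by rewrite cosB !addr0 !cosDpihalf; ring.
rewrite exchange_big mulr_sumr /=; apply: eq_bigr => j _.
rewrite exchange_big /= (bigD1 j) //= [X in _ + X]big1 ?addr0 => [|j' jj'].
  rewrite subrr (eq_bigr (fun=> F j ^+ 2)).
    by rewrite sumr_const mulr_natl.
  move=> k _; rewrite addr0 /angle big1 ?mulr0 ?cos0 ?mulr1 ?expr2 // => i _.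
  by rewrite mxE muln0.
by rewrite -mulr_sumr sum_cos_angle ?mulr0 // subr_eq0 eq_sym.
Qed.

Definition dlaplacian F j : R :=
  \sum_i (F (j + unit_step i) + F (j - unit_step i) - 2 * F j).

(** The Fourier multiplier of the discrete Laplacian, up to sign. *)
Definition symbol k : R := \sum_i 2 * (1 - cos (w * (k 0%R i : nat)%:R)).

Lemma coef_dlaplacian F k t : coef (dlaplacian F) k t = - symbol k * coef F k t.
Proof.
rewrite /coef /dlaplacian.
under eq_bigr do rewrite mulr_suml.
rewrite exchange_big /= mulNr /symbol mulr_suml -sumrN; apply: eq_bigr => i _.
rewrite -angle_unit_step; set e := unit_step i.
under eq_bigr do rewrite mulrBl mulrDl.
rewrite sumrB big_split /= (reindex_inj (addIr (- e))) /=.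
rewrite [X in _ + X - _](reindex_inj (addIr e)) /= -big_split /= -sumrB mulr_sumr -sumrN.
apply: eq_bigr => j _; rewrite subrK addrK -mulrDr.
have -> : cos (angle k (j - e) + t) = cos (angle k j + t - angle k e).
  rewrite -[in RHS](subrK e j) -addrA (cos_angleDr k (j - e) e).
  by congr cos; ring.
rewrite cos_angleDr (addrAC _ (angle k e)) (cosD _ (angle k e)) (cosB _ (angle k e)); ring.
Qed.

Lemma coefD F F' k t : coef (fun j => F j + F' j) k t = coef F k t + coef F' k t.
Proof. by rewrite -big_split; apply: eq_bigr => j _; rewrite mulrDl. Qed.

Lemma coefZ a F k t : coef (fun j => a * F j) k t = a * coef F k t.
Proof. by rewrite mulr_sumr; apply: eq_bigr => j _; rewrite mulrA. Qed.

(** The character of [k] takes the value [(-1) ^ (sum of the entries of k)] at the half-period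
    vector, so invariance of [F] kills the odd frequencies. *)
Lemma coef_odd F k t (M : nat) : N = M.*2 ->
  (forall j, F (j + const_mx (inord M)) = F j) ->
  odd (\sum_i k 0%R i) -> coef F k t = 0.
Proof.
move=> NM Fh ok; set H : G := const_mx (inord M).
have MN : (M < N)%N by lia.
have kH : angle k H = pi + 2 * pi * ((\sum_i k 0%R i)./2)%N%:R.
  rewrite /angle.
  have -> : (\sum_i k 0%R i * H 0%R i = M * \sum_i k 0%R i)%N.
    by rewrite big_distrr; apply: eq_bigr => i _; rewrite mxE inordK // mulnC.
  have NR : N%:R = 2 * M%:R :> R by rewrite -natrM mul2n -NM.
  rewrite -[X in (M * X)%N]odd_double_half ok NR -mul2n !(natrM, natrD) /=.
  have M0 : M%:R != 0 :> R by rewrite pnatr_eq0; lia.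
  by field.
have : coef F k t = - coef F k t.
  rewrite {1}/coef (reindex_inj (addIr H)) /= /coef -sumrN; apply: eq_bigr => j _.
  rewrite Fh cos_angleDr kH addrAC -mulrN; congr (_ * _).
  by rewrite addrA cosDint ?rpred_nat // cosDpi.
by move=> h; lra.
Qed.

(** An approximate eigenfunction whose eigenvalue stays at distance [dl] from the spectrum must be
    small. At [k = 0] the distance is [l >= dl], at nonzero even [k] it comes from the hypothesis on
    [symbol], and odd [k] do not occur; Parseval converts this into mean squares. *)
Lemma discrete_estimate F (M : nat) (l s dl eps : R) : N = M.*2 ->
  (forall j, F (j + const_mx (inord M)) = F j) -> 0 < dl -> dl <= l ->
  (forall k, k != 0 -> ~~ odd (\sum_i k 0%R i) -> l + dl <= s * symbol k) ->
  (forall j, `|s * dlaplacian F j + l * F j| <= eps) ->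
  dl ^+ 2 * \sum_j F j ^+ 2 <= eps ^+ 2 * #|{: G}|%:R.
Proof.
move=> NM Fh dl0 dll sym_k Eeps.
pose E j := s * dlaplacian F j + l * F j.
have cE k t : coef E k t = (l - s * symbol k) * coef F k t.
  by rewrite coefD !coefZ coef_dlaplacian; ring.
have key k t : dl ^+ 2 * coef F k t ^+ 2 <= coef E k t ^+ 2.
  have [ok|ek] := boolP (odd (\sum_i k 0%R i)).
    by rewrite (coef_odd t NM Fh ok) expr0n mulr0 sqr_ge0.
  rewrite cE exprMn ler_wpM2r ?sqr_ge0 //.
  have [->|k0] := eqVneq k 0.
    have -> : symbol 0 = 0.
      by rewrite /symbol big1 // => i _; rewrite mxE mulr0 cos0 subrr mulr0.
    by rewrite mulr0 subr0 lerXn2r // nnegrE; lra.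
  have h := sym_k k k0 ek; rewrite -[X in _ <= X]sqrrN.
  have h' : dl <= - (l - s * symbol k) by rewrite opprB lerBrDl.
  by rewrite lerXn2r ?nnegrE // ltW // (lt_le_trans dl0).
have G0 : 0 < #|{: G}|%:R :> R by rewrite ltr0n; apply/card_gt0P; exists 0.
rewrite -(ler_pM2l G0) mulrCA -parseval mulr_sumr.
apply: le_trans (_ : #|{: G}|%:R * \sum_j E j ^+ 2 <= _).
  rewrite -parseval; apply: ler_sum => k _; rewrite mulrDr; apply: lerD; exact: key.
rewrite ler_pM2l // mulr_natr -sumr_const; apply: ler_sum => j _.
have e0 : 0 <= eps by exact: le_trans (Eeps j).
rewrite -[E j ^+ 2]real_normK ?num_real //.
by apply: lerXn2r; rewrite ?nnegrE //; exact: Eeps.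
Qed.

(** If some entry lies between [2] and [N - 2], that entry alone suffices, by [psi12]. Otherwise
    every nonzero entry is [1] or [N - 1], which is odd, and parity forces at least two of them. *)
Lemma symbol_ge k (M : nat) : N = M.*2 -> (2 <= M)%N -> k != 0 ->
  ~~ odd (\sum_i k 0%R i) -> 4 * (1 - cos w) <= symbol k.
Proof.
move=> NM M2 k0 ek.
pose psi (a : nat) : R := 1 - cos (w * a%:R).
have p0 : 0 < pi :> R := pi_gt0 R.
have N0 : 0 < N%:R :> R by rewrite ltr0n.
have w0 : 0 < w by rewrite divr_gt0 // mulr_gt0.
have wN : w * N%:R = 2 * pi by rewrite divfK // natN_neq0.
have wM : w * M%:R = pi by move: wN; rewrite NM -mul2n natrM; lra.
have psi0 a : 0 <= psi a by rewrite subr_ge0 cos_le1.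
have psi_mono a b : (a <= b)%N -> (b <= M)%N -> psi a <= psi b.
  move=> ab bM.
  have wab : w * a%:R <= w * b%:R by rewrite ler_pM2l // ler_nat.
  have wbM : w * b%:R <= pi by rewrite -[X in _ <= X]wM ler_pM2l // ler_nat.
  have wa0 : 0 <= w * a%:R by rewrite mulr_ge0 // ltW.
  by rewrite lerD2l lerN2 le_cos.
have psiN a : (a <= N)%N -> psi (N - a)%N = psi a.
  move=> aN; rewrite /psi natrB // mulrBr wN; congr (1 - _).
  have := @cosDint R (- (w * a%:R)) 1 (rpred1 _).
  by rewrite mulr1 cosN [X in cos X]addrC.
have psi_ge a b : (a <= b)%N -> (b <= N - a)%N -> psi a <= psi b.
  move=> ab bN; have [bM|Mb] := leqP b M; first exact: psi_mono.
  by rewrite -(psiN b); [apply: psi_mono; lia|lia].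
(* [1 - cos (2 w) = 2 (1 - cos w) (1 + cos w)], and [cos w >= 0] because [N >= 4]. *)
have psi12 : 2 * psi 1%N <= psi 2%N.
  have c0 : 0 <= cos w.
    apply: cos_ge0_pihalf; apply/andP; split.
      by apply: le_trans (ltW w0); rewrite oppr_le0 divr_ge0 // ltW.
    by rewrite ler_pdivlMr // -[X in _ <= X]wM ler_pM2l // ler_nat.
  have c1 := cos_le1 w.
  rewrite /psi mulr1 mulr_natr cos_mulr2n.
  have : 0 <= cos w * (1 - cos w) by rewrite mulr_ge0 // subr_ge0.
  by rewrite -mulr_natl; lra.
have symE : symbol k = 2 * \sum_i psi (k 0%R i) by rewrite mulr_sumr.
have -> : 4 * (1 - cos w) = 2 * (2 * psi 1%N) by rewrite /psi mulr1; ring.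
rewrite symE ler_pM2l //.
have [i ki|allk] := pickP (fun i => (2 <= k 0%R i)%N && (k 0%R i <= N - 2)%N).
  have /andP[k2 kN] := ki.
  apply: le_trans psi12 _; apply: le_trans (psi_ge _ _ k2 kN) _.
  by rewrite (bigD1 i) //= lerDl sumr_ge0.
have odd_k i : k 0%R i != 0 -> odd (k 0%R i).
  move=> ki0; have ki : (k 0%R i != 0 :> nat)%N by [].
  have := allk i; have := ltn_ord (k 0%R i).
  have [k1|k2] : (k 0%R i = 1 :> nat)%N \/ (1 < k 0%R i)%N by lia.
    by rewrite k1.
  move=> kN kk; have -> : (k 0%R i = M.*2.-1 :> nat)%N by rewrite -NM; lia.
  by rewrite -(prednK (n := M)) ?doubleS /= ?odd_double //; lia.
have psi1 i : k 0%R i != 0 -> psi 1%N <= psi (k 0%R i).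
  move=> ki0; have ki : (k 0%R i != 0 :> nat)%N by []; apply: psi_ge; first by lia.
  by have := ltn_ord (k 0%R i); lia.
have [i ki] : exists i, k 0%R i != 0.
  apply/existsP; apply: contraNT k0; rewrite negb_exists => /forallP h.
  by apply/eqP/rowP => i; rewrite mxE; apply/eqP; have := h i; rewrite negbK.
have [i' ki' |all0] := pickP (fun i' => (i' != i) && (k 0%R i' != 0)).
  have /andP[ii' ki'0] := ki'.
  rewrite (bigD1 i) //= (bigD1 i') //= addrA.
  apply: le_trans (_ : psi (k 0%R i) + psi (k 0%R i') <= _); last by rewrite lerDl sumr_ge0.
  by have := psi1 i ki; have := psi1 i' ki'0; lra.
move: ek; rewrite (bigD1 i) //= big1 ?addn0 ?odd_k // => i' ii'.
by have := all0 i'; rewrite ii' /= => /negbFE/eqP ->.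
Qed.

End DiscreteFourier.

(** * Sampling an eigenfunction on a fine grid *)

Section Grid.
Context {R : realType} {n : nat}.
Variables (L : set 'rV[R]_n) (P : 'M[R]_n) (c : R).
Hypothesis c0 : 0 < c.
Hypothesis P_orth : P *m P^T = c%:M.
Hypothesis LP : forall z : 'rV[int]_n, L (intmx z *m P).
Hypothesis L_half : L (const_mx 2^-1 *m P).

Definition grid_pos {N' : nat} (j : 'rV['I_N'.+2]_n) : 'rV[R]_n :=
  \row_i ((j 0 i : nat)%:R / N'.+2%:R).

Definition grid {N' : nat} (x : 'rV[R]_n) (j : 'rV['I_N'.+2]_n) : 'rV[R]_n :=
  x + grid_pos j *m P.

Lemma frame_unit : P \in unitmx.
Proof.
suff /mulmx1_unit[//] : P *m (c^-1 *: P^T) = 1%:M.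
by rewrite -scalemxAr P_orth scale_scalar_mx mulVf // gt_eqF.
Qed.

Lemma frame_orthC : P^T *m P = c%:M.
Proof.
have : (c^-1 *: P^T) *m P = 1%:M.
  by apply: mulmx1C; rewrite -scalemxAr P_orth scale_scalar_mx mulVf // gt_eqF.
rewrite -scalemxAl => /(congr1 ( *:%R c)).
by rewrite scalerA divff ?gt_eqF // scale1r scale_scalar_mx mulr1.
Qed.

(** Indices add modulo [N]; the carries are integer combinations of the rows of [P], which are
    periods of [f]. *)
Lemma periodic_gridD N' f x (j j' : 'rV['I_N'.+2]_n) v : Defs.periodic L f ->
  f (grid x (j + j') + v) = f (grid x j + grid_pos j' *m P + v) :> R.
Proof.
move=> pf.
pose q : 'rV[int]_n := \row_i ((j 0%R i + j' 0%R i) %/ N'.+2)%N%:Z.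
rewrite -(pf _ (LP q)); congr f; rewrite /grid -!addrA; congr (_ + _).
rewrite addrCA [RHS]addrA [RHS]addrC -!mulmxDl; congr (_ + _ *m _).
apply/rowP => i; rewrite !mxE /=.
have N0 : N'.+2%:R != 0 :> R by rewrite pnatr_eq0.
apply: (mulIf N0); rewrite !mulrDl !divfK // -pmulrn -natrM -!natrD; congr (_%:R).
by rewrite [in RHS](divn_eq (j 0%R i + j' 0%R i) N'.+2) addnC.
Qed.

Lemma grid_pos_unit_step N' i :
  grid_pos (unit_step i : 'rV['I_N'.+2]_n) *m P = N'.+2%:R^-1 *: row i P.
Proof.
rewrite rowE scalemxAl; congr (_ *m _); apply/rowP => a; rewrite !mxE eqxx /=.
by case: eqP => _; rewrite ?inordK //= ?mul0r ?mulr0 ?mul1r ?mulr1.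
Qed.

(** A grid step has square length [c / N^2], so [N^2 / c] is the right normalisation. Third
    derivatives are bounded by periodicity, which makes [A] independent of [N], of the base point
    and of the grid point. *)
Lemma grid_laplacian (l : R) f : smooth f -> Defs.periodic L f ->
  (forall x, - laplacian f x = l * f x) ->
  exists2 A, 0 <= A & forall N' x (j : 'rV['I_N'.+2]_n),
    `|N'.+2%:R ^+ 2 / c * dlaplacian (fun j => f (grid x j)) j + l * f (grid x j)|
      <= A / N'.+2%:R.
Proof.
move=> sf pf lapf.
have bounded i : exists K, 0 <= K /\ forall x,
    `|'D_(row i P) ('D_(row i P) ('D_(row i P) f)) x| <= K.
  have s3 := smooth_derive (row i P) (smooth_derive (row i P) (smooth_derive (row i P) sf)).
  have p3 := periodic_derive (row i P) (periodic_derive (row i P) (periodic_derive (row i P) pf)).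
  have [K K0 hK] := periodic_bounded (class_C_continuous (s3 0%N)) p3 frame_unit LP.
  by exists K.
have [K hK] := choice bounded.
exists (2 / c * \sum_i K i).
  by rewrite mulr_ge0 ?divr_ge0 ?(ltW c0) // sumr_ge0 // => i _; have [] := hK i.
move=> N' x j; set N : R := N'.+2%:R; set y := grid x j.
have N0 : 0 < N by rewrite ltr0n.
pose D i := 'D_(row i P) ('D_(row i P) f) y.
have dlE : dlaplacian (fun j => f (grid x j)) j =
    \sum_i (f (y + N^-1 *: row i P) + f (y - N^-1 *: row i P) - 2 * f y).
  apply: eq_bigr => i _; congr (_ + _ - _).
    by have := @periodic_gridD _ f x j (unit_step i) 0 pf; rewrite !addr0 grid_pos_unit_step.
  have := @periodic_gridD _ f x (j - unit_step i) (unit_step i) (- (N^-1 *: row i P)) pf.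
  by rewrite subrK grid_pos_unit_step addrK.
have Dsum : \sum_i D i = - (c * l * f y).
  rewrite (smooth_laplacian_frame _ sf frame_orthC) -[laplacian f y]opprK lapf.
  by rewrite mulrN mulrA.
have -> : N ^+ 2 / c * dlaplacian (fun j => f (grid x j)) j + l * f y =
    N ^+ 2 / c * \sum_i (f (y + N^-1 *: row i P) + f (y - N^-1 *: row i P) - 2 * f y
                          - N^-1 ^+ 2 * D i).
  rewrite dlE [X in _ = _ * X]sumrB -mulr_sumr Dsum.
  by field; rewrite !gt_eqF.
rewrite normrM ger0_norm ?divr_ge0 ?exprn_ge0 ?(ltW N0) ?(ltW c0) //.
apply: le_trans (_ : N ^+ 2 / c * \sum_i (2 * K i * N^-1 ^+ 3) <= _).
  apply: ler_wpM2l; first by rewrite divr_ge0 ?exprn_ge0 ?(ltW N0) ?(ltW c0).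
  apply: le_trans (ler_norm_sum _ _ _) _; apply: ler_sum => i _.
  have [_ hKi] := hK i.
  have := second_difference sf hKi y N^-1.
  by rewrite [`|N^-1|]ger0_norm ?invr_ge0 ?(ltW N0).
rewrite -mulr_suml -mulr_sumr le_eqVlt; apply/orP; left; apply/eqP.
by field; rewrite !gt_eqF.
Qed.

(** Half of the second difference estimate for [cos], whose third derivative is bounded by [1]. *)
Lemma cos_lower_bound (h : R) : 0 <= h -> h ^+ 2 / 2 - h ^+ 3 <= 1 - cos h.
Proof.
move=> h0.
have dNs (t : R) : is_derive t 1 (fun x => - sin x) (- cos t) by apply: is_deriveN.
have dNc (t : R) : is_derive t 1 (fun x => - cos x) (sin t).
  by apply: is_derive_eq; rewrite opprK.
have b (t : R) : `|sin t| <= 1 := sin_max t.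
have := @second_difference1 R cos _ _ _ 1 (fun t => is_derive_cos t) dNs dNc b h.
by rewrite cosN cos0 ler_norml (ger0_norm h0); lra.
Qed.

(** These are the grid points near the base point: a proportion of at least [Q^-n] of the grid,
    however fine it is. *)
Lemma grid_small_card (Q m N' : nat) : N'.+2 = (Q * m)%N -> (0 < Q)%N ->
  (m ^ n <= #|[set j : 'rV['I_N'.+2]_n | [forall i, (j 0%R i < m)%N]]%SET|)%N.
Proof.
move=> NE Q0.
have mN : (m <= N'.+2)%N by rewrite NE leq_pmull.
pose emb (j : 'rV['I_m]_n) : 'rV['I_N'.+2]_n := map_mx (widen_ord mN) j.
have embI : injective emb.
  by move=> j j' /matrixP h; apply/matrixP => a b; have := h a b; rewrite !mxE => /(congr1 val) /= /val_inj.
have -> : (m ^ n = #|emb @: [set: 'rV['I_m]_n]%SET|)%N.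
  by rewrite card_imset // cardsT card_mx card_ord mul1n.
apply: subset_leq_card; apply/fintype.subsetP => _ /imsetP[j _ ->]; rewrite inE.
by apply/forallP => i; rewrite mxE /=.
Qed.

(** If [l] were smaller, the samples of [f] would be approximate eigenvectors away from the discrete
    spectrum, so their mean square would be [O(1 / N^2)]. But [f] stays away from zero near [x0], on
    a fixed proportion of the grid. *)
Lemma eigenvalue_lower_bound (l : R) : 0 < l -> laplace_eigenvalue L l ->
  8 * pi ^+ 2 / c <= l.
Proof.
move=> l0 [f [sf pf [x0 fx0] lapf]]; rewrite leNgt; apply/negP => lc.
have [A A0 hA] := grid_laplacian sf pf lapf.
pose g := 8 * pi ^+ 2 / c - l.
have g0 : 0 < g by rewrite subr_gt0.
(* Distance kept from the eigenvalue [0] and from the others; the other half of [g] absorbs the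
   error in the symbol. *)
pose dl := Num.min l (g / 2).
have dl0 : 0 < dl by rewrite lt_min l0 divr_gt0.
have b0 : 0 < `|f x0| / 2 by rewrite divr_gt0 // normr_gt0.
have [r r0 hr] : exists2 r : R, 0 < r & forall y : 'rV[R]_n,
    (forall i, `|x0 0 i - y 0 i| < r) ->
    `|f x0| / 2 <= `|f y|.
  have /cvgrPdist_le/(_ _ b0)/nbhs_ballP[r /= r0 hr] := class_C_continuous (sf 0%N) (x := x0).
  exists r => // y hy; have := hr y.
  have xy : ball x0 r y by split=> // i j; rewrite ord1 -ball_normE /=; exact: hy.
  move=> /(_ xy) h; have := ler_normD (f x0 - f y) (f y); rewrite subrK; lra.
pose S : R := 1 + \sum_a \sum_b `|P a b|.
have S0 : 0 < S by rewrite ltr_pwDl // sumr_ge0 // => a _; rewrite sumr_ge0.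
have nat_above (x : R) : exists k : nat, x < k%:R.
  by exists (Num.bound `|x|); apply: le_lt_trans (ler_norm x) (archi_boundP _).
have [Q' hQ'] := nat_above (S / r).
(* Grid points with all coordinates below [1 / Q] in the frame stay within [r] of [x0] in every
   coordinate. *)
pose Q := Q'.+1.
have Qr : S / Q%:R < r.
  rewrite ltr_pdivrMr ?ltr0n // -ltr_pdivrMl // mulrC.
  by apply: lt_trans hQ' _; rewrite ltr_nat.
(* Lower bound for [dl^2] times the mean square of the samples, to be contradicted by
   [(A / N)^2]. *)
pose th := dl ^+ 2 * (`|f x0| / 2) ^+ 2 / Q%:R ^+ n.
have th0 : 0 < th by apply: divr_gt0; [apply: mulr_gt0|]; apply: exprn_gt0.
(* [m1] makes the symbol error [32 pi^3 / (N c)] at most [g / 2]; [m2] gives the final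
   contradiction. *)
have [m1 hm1] := nat_above (64 * pi ^+ 3 / (c * g)).
have [m2 hm2] := nat_above (A ^+ 2 / th).
pose m := (m1 + m2 + 2)%N.
have mp : (m <= Q * m)%N by rewrite leq_pmull.
have pE : (Q * m.*2 = (Q * m).*2)%N by rewrite -doubleMr.
(* [N = 2 Q m] is even, as the half-sum translation requires, and a multiple of [Q]; the shift by
   two matches ['I_N'.+2]. *)
pose N' := ((Q * m).*2).-2.
have M2 : (2 <= Q * m)%N by apply: leq_trans mp; rewrite leq_addl.
have NM : N'.+2 = (Q * m).*2 by rewrite /N'; case: (Q * m)%N M2 => // -[].
have NE : N'.+2 = (Q * m.*2)%N by rewrite NM pE.
have mN : (m <= N'.+2)%N by rewrite NM (leq_trans mp) // -addnn leq_addr.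
have m1N : (m1 <= N'.+2)%N by apply: leq_trans mN; rewrite /m -addnA leq_addr.
have m2N : (m2 <= N'.+2)%N by apply: leq_trans mN; rewrite /m addnAC leq_addl.
have hm1N : 64 * pi ^+ 3 / (c * g) < N'.+2%:R.
  by apply: lt_le_trans hm1 _; rewrite ler_nat.
have hm2N : A ^+ 2 / th < N'.+2%:R.
  by apply: lt_le_trans hm2 _; rewrite ler_nat.
have N1 : 1 <= N'.+2%:R :> R by rewrite ler1n.
have NER : N'.+2%:R = (Q * m.*2)%N%:R :> R by rewrite NE.
have NMR : N'.+2%:R = 2 * (Q * m)%N%:R :> R by rewrite NM -mul2n natrM.
clearbody N'.
have small (j : 'rV['I_N'.+2]_n) : (forall i, (j 0%R i < m.*2)%N) ->
    (`|f x0| / 2) ^+ 2 <= f (grid x0 j) ^+ 2.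
  move=> jm; rewrite -[f (grid x0 j) ^+ 2]real_normK ?num_real //.
  rewrite lerXn2r ?nnegrE ?(ltW b0) //; apply: hr => i.
  rewrite mxE opprD addrA subrr sub0r normrN; apply: le_lt_trans Qr.
  rewrite mxE; apply: le_trans (ler_norm_sum _ _ _) _.
  rewrite /S mulrDl mul1r -[leLHS]add0r lerD ?invr_ge0 //.
  rewrite mulr_suml; apply: ler_sum => a _; rewrite mulrC normrM.
  rewrite ler_pM //; first by rewrite (bigD1 i) //= lerDl sumr_ge0.
  rewrite mxE ger0_norm ?divr_ge0 // ler_pdivrMr ?ltr0n // ler_pdivlMl ?ltr0n //.
  by rewrite NER -natrM ler_nat leq_mul2l ltnW ?orbT.
have F_half (j : 'rV['I_N'.+2]_n) :
    f (grid x0 (j + const_mx (inord (Q * m)))) = f (grid x0 j).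
  have := @periodic_gridD N' f x0 j (const_mx (inord (Q * m))) 0 pf.
  rewrite !addr0 => ->; suff -> : grid_pos (const_mx (inord (Q * m)) : 'rV['I_N'.+2]_n)
    = const_mx 2^-1 by exact: pf.
  apply/rowP => i; rewrite !mxE inordK; last first.
    by rewrite NM -addnn -[X in (X < _)%N]addn0 ltn_add2l (leq_trans _ M2).
  rewrite NMR; have Qm0 : (Q * m)%:R != 0 :> R by rewrite pnatr_eq0 -lt0n (leq_trans _ M2).
  by rewrite invfM mulrCA divff // mulr1.
have sym (k : 'rV['I_N'.+2]_n) : k != 0 -> ~~ odd (\sum_i k 0%R i) ->
    l + dl <= N'.+2%:R ^+ 2 / c * symbol k.
  move=> k0 ek; have := @symbol_ge R n N' k (Q * m) NM M2 k0 ek.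
  set N : R := N'.+2%:R; have N0 : 0 < N by exact: lt_le_trans N1.
  have w0 : 0 <= 2 * pi / N by rewrite divr_ge0 ?mulr_ge0 ?pi_ge0 // ltW.
  have := cos_lower_bound w0; set w := 2 * pi / N => cw sw.
  have s0 : 0 < N ^+ 2 / c by rewrite divr_gt0 ?exprn_gt0.
  apply: le_trans (_ : N ^+ 2 / c * (4 * (w ^+ 2 / 2 - w ^+ 3)) <= _); last first.
    by apply: (ler_wpM2l (ltW s0)); apply: le_trans sw; rewrite ler_pM2l.
  have -> : N ^+ 2 / c * (4 * (w ^+ 2 / 2 - w ^+ 3)) =
      8 * pi ^+ 2 / c - 32 * pi ^+ 3 / (N * c).
    by rewrite /w; field; rewrite !gt_eqF.
  have : 32 * pi ^+ 3 / (N * c) <= g / 2.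
    rewrite ler_pdivrMr ?mulr_gt0 //.
    by move: hm1N; rewrite ltr_pdivrMr ?mulr_gt0 // -/N => /ltW h; lra.
  have : dl <= g / 2 by rewrite ge_min lexx orbT.
  have -> : 8 * pi ^+ 2 / c = l + g by rewrite addrC subrK.
  move: (32 * pi ^+ 3 / (N * c)) => X dg Xg.
  by rewrite -addrA lerD2l lerBrDr [leRHS](splitr g) lerD.
have := @discrete_estimate R n N' (fun j => f (grid x0 j)) (Q * m) l
  (N'.+2%:R ^+ 2 / c) dl (A / N'.+2%:R) NM F_half dl0 _ sym (hA N' x0).
rewrite ge_min lexx => /(_ isT) est.
have lower : (`|f x0| / 2) ^+ 2 * (m.*2 ^ n)%N%:R <=
    \sum_(j : 'rV['I_N'.+2]_n) f (grid x0 j) ^+ 2.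
  have := grid_small_card NE (ltn0Sn Q'); set J := (X in #|X|) => cJ.
  apply: le_trans (_ : (`|f x0| / 2) ^+ 2 * #|J|%:R <= _).
    by rewrite ler_wpM2l ?sqr_ge0 // ler_nat.
  rewrite mulr_natr -sumr_const [leRHS](bigID (mem J)) /= -[leLHS]addr0 lerD ?sumr_ge0 //;
    last by move=> j _; exact: sqr_ge0.
  by apply: ler_sum => j; rewrite inE => /forallP jm; exact: small.
have cG : #|{: 'rV['I_N'.+2]_n}|%:R = Q%:R ^+ n * (m.*2 ^ n)%N%:R :> R.
  by rewrite card_mx card_ord mul1n -natrX -natrM -expnMn NE.
have mn0 : 0 < (m.*2 ^ n)%N%:R :> R.
  by rewrite ltr0n expn_gt0 double_gt0 /m addn2.
have : th <= (A / N'.+2%:R) ^+ 2.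
  rewrite ler_pdivrMr ?exprn_gt0 ?ltr0n // -(ler_pM2r mn0).
  rewrite -(mulrA (dl ^+ 2)) -(mulrA ((A / N'.+2%:R) ^+ 2)) -cG.
  by apply: le_trans est; rewrite ler_pM2l ?exprn_gt0.
apply/negP; rewrite -ltNge.
move: hm2N; rewrite ltr_pdivrMr // => h.
rewrite expr_div_n ltr_pdivrMr ?exprn_gt0 ?(lt_le_trans _ N1) //.
apply: lt_le_trans h _; rewrite mulrC ler_pM2l // expr2 ler_peMr //.
Qed.

End Grid.

(** * The extremal tori *)

Lemma dotE (R : realType) (n : nat) (u v : 'rV[R]_n) : dot u v = (u *m v^T) 0 0.
Proof. by rewrite mxE; apply: eq_bigr => i _; rewrite mxE. Qed.

Lemma dot_intmx (R : realType) (n : nat) (z y : 'rV[int]_n) (A B : 'M[R]_n) :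
  A *m B^T = 1%:M -> dot (intmx z *m A) (intmx y *m B) \is a Num.int.
Proof.
move=> AB; rewrite dotE trmx_mul mulmxA -(mulmxA _ A) AB mulmx1 mxE.
by apply: rpred_sum => i _; rewrite !mxE rpredM // rpred_int.
Qed.

Lemma dual_lattice_intmx (R : realType) (n : nat) (B : 'M[R]_n) (z : 'rV[int]_n) :
  B \in unitmx -> dual_lattice (lattice B) (intmx z *m (invmx B)^T).
Proof.
move=> uB v [y ->]; apply: dot_intmx.
by rewrite -trmx_mul mulmxV // trmx1.
Qed.

Lemma intmx_of_int (R : realType) (n : nat) (v : 'rV[R]_n) :
  (forall i, v 0 i \is a Num.int) -> exists z : 'rV[int]_n, v = intmx z.
Proof.
move=> vi; exists (\row_i Num.floor (v 0 i)).
by apply/rowP => i; rewrite !mxE floorK.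
Qed.

Lemma row_intmx (R : realType) (n : nat) (A : 'M[R]_n) i :
  row i A = intmx (delta_mx 0 i) *m A.
Proof. by rewrite rowE (map_delta_mx intr). Qed.

(** The coordinates of [v] in the dual basis are its products with the rows of [B]. *)
Lemma mem_dual_lattice (R : realType) (n : nat) (B : 'M[R]_n) (v : 'rV[R]_n) :
  B \in unitmx -> dual_lattice (lattice B) v ->
  exists z : 'rV[int]_n, v = intmx z *m (invmx B)^T.
Proof.
move=> uB vB; have [i|z zE] := @intmx_of_int R n (v *m B^T).
  have -> : (v *m B^T) 0 i = dot v (row i B).
    by rewrite mxE; apply: eq_bigr => k _; rewrite !mxE.
  by apply: vB; exists (delta_mx 0 i); exact: row_intmx.
by exists z; rewrite -zE trmx_inv mulmxK // unitmx_tr.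
Qed.

Lemma intmx_rows (R : realType) (n : nat) (A B : 'M[R]_n) :
  (forall i, exists z : 'rV[int]_n, row i A = intmx z *m B) ->
  exists Z : 'M[int]_n, A = intmx Z *m B.
Proof.
move=> /choice[z zE]; exists (\matrix_i z i); apply/row_matrixP => i.
rewrite zE row_mul; congr (_ *m _); apply/rowP => j; by rewrite !mxE.
Qed.

Section DualBasis.
Context {R : realType} {n : nat}.
Variables (B D : 'M[R]_n).
Hypothesis uB : B \in unitmx.
Hypothesis D_dual : lattice_basis (dual_lattice (lattice B)) D.

(** Each of the two bases of the dual lattice is integral in the other, and real invertibility makes
    the two integer matrices mutually inverse. *)
Lemma dual_basis_change :
  exists2 Z : 'M[int]_n, Z \in unitmx & (invmx B)^T = intmx Z *m D.
Proof.
have [uD dualE] := D_dual.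
have [i|Z ZE] := @intmx_rows R n (invmx B)^T D.
  have : dual_lattice (lattice B) (row i (invmx B)^T).
    by rewrite row_intmx; exact: dual_lattice_intmx.
  by rewrite dualE.
have [i|W WE] := @intmx_rows R n D (invmx B)^T.
  apply: mem_dual_lattice => //; rewrite dualE; exists (delta_mx 0 i); exact: row_intmx.
exists Z => //.
have : intmx (Z *m W) = intmx 1%:M :> 'M[R]_n.
  rewrite intmx_mul (map_mx1 intr).
  have uBT : (invmx B)^T \in unitmx by rewrite unitmx_tr unitmx_inv.
  by apply: (can_inj (mulmxK uBT)); rewrite mul1mx -mulmxA -WE -ZE.
move=> ZW; suff /mulmx1_unit[//] : Z *m W = 1%:M.
by apply/matrixP => i j; apply/eqP; rewrite -(eqr_int R); apply/eqP;
  move/matrixP/(_ i j): ZW; rewrite !mxE.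
Qed.

Lemma det_dual_basis : `|\det B| * `|\det D| = 1.
Proof.
have [Z uZ /(congr1 (fun A => `|\det A|))] := dual_basis_change.
rewrite det_tr det_inv det_mulmx normrM norm_det_intmx // mul1r normfV => <-.
by rewrite divff // normr_eq0 -unitfE -unitmxE.
Qed.

(** Biduality: with [Z] from the change of dual basis, the basis dual to [D] is [Z^T B]. *)
Lemma dual_basis_lattice (z : 'rV[int]_n) : lattice B (intmx z *m (invmx D)^T).
Proof.
have [Z uZ BZ] := dual_basis_change; have [uD _] := D_dual.
exists (z *m Z^T); rewrite intmx_mul -mulmxA; congr (_ *m _).
apply: (can_inj (@trmxK _ _ _)); rewrite trmxK trmx_mul (map_trmx intr) trmxK.
have -> : B^T = invmx (intmx Z *m D) by rewrite -BZ -trmx_inv invmxK.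
have uZR := @intmx_unit R _ _ uZ.
apply: (can_inj (mulKmx uD)); rewrite mulmxV // mulmxA.
apply: (can_inj (mulKmx uZR)).
by rewrite mulmx1 !mulmxA mulmxV ?unitmx_mul ?uZR // mul1mx.
Qed.

End DualBasis.

(* In the orthogonal frame given by the rows of [P], the conditions force [L] to
   be a homothetic copy of the dual of the root lattice D_n. *)
Definition Dn_frame (R : realType) (n : nat) (L : set 'rV[R]_n) (P : 'M[R]_n) (c : R) :=
  [/\ 0 < c, P *m P^T = c%:M, forall z : 'rV[int]_n, L (intmx z *m P),
      L (const_mx 2^-1 *m P)
    & forall i j (s : bool), dual_lattice L (c^-1 *: (row i P + (-1) ^+ s *: row j P))].

Lemma Dn_frame_scale (R : realType) (n : nat) (B P : 'M[R]_n) (c r : R) :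
  0 < r -> Dn_frame (lattice B) P c ->
  Dn_frame (lattice (r *: B)) (r *: P) (r ^+ 2 * c).
Proof.
move=> r0 [c0 PP LP Lh dualP].
have scale v : lattice B v -> lattice (r *: B) (r *: v).
  by move=> [z ->]; exists z; rewrite scalemxAr.
split; first by rewrite mulr_gt0 ?exprn_gt0.
- by rewrite linearZ /= -scalemxAl -scalemxAr PP scalerA -expr2 scale_scalar_mx.
- by move=> z; rewrite -scalemxAr; exact: scale.
- by rewrite -scalemxAr; exact: scale.
move=> i j s _ [z ->].
have := dualP i j s _ (ex_intro _ z erefl).
set a := (X in dot X _ \is a _ -> _); set a' := (X in _ -> dot X _ \is a _).
have -> : a' = r^-1 *: a.
  rewrite /a /a' !scalerA !linearZ /= scalerA mulrC -scalerA -scalerDr scalerA; congr (_ *: _).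
  by field; rewrite !gt_eqF.
by move: a => {}a; rewrite -scalemxAr dotZl dotZr mulKf ?gt_eqF.
Qed.

Section DnFrame.
Context {R : realType} {n : nat}.
Variables (L : set 'rV[R]_n.+2) (P : 'M[R]_n.+2) (c : R).
Hypothesis frameP : Dn_frame L P c.

Let c0 : 0 < c. Proof. by have [] := frameP. Qed.

Let cn0 : c != 0. Proof. by rewrite gt_eqF. Qed.

Local Notation T := ('I_n.+2 * 'I_n.+1 * bool)%type.

(** [lift i k] runs over the indices other than [i], so the roots are indexed by ordered pairs; each
    one occurs twice up to sign. *)
Definition Dn_root (t : T) : 'rV[R]_n.+2 :=
  c^-1 *: (row t.1.1 P + (-1) ^+ t.2 *: row (lift t.1.1 t.1.2) P).

Lemma dot_rows i j : dot (row i P) (row j P) = c * (i == j)%:R.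
Proof. by have [_ PP _ _ _] := frameP; rewrite -dot_gram PP mxE mulr_natr. Qed.

Lemma Dn_root_norm t : dot (Dn_root t) (Dn_root t) = 2 / c.
Proof.
rewrite /Dn_root !(dotZl, dotZr, dotDl, dotDr) !dot_rows !eqxx.
rewrite [lift _ _ == _]eq_sym !(negbTE (neq_lift _ _)).
by case: t.2; rewrite /= ?expr0 ?expr1; field.
Qed.

Lemma Dn_root_dual t : dual_lattice L (Dn_root t).
Proof. by have [_ _ _ _ h] := frameP; exact: h. Qed.

Lemma Dn_root_neq0 t : Dn_root t != 0.
Proof. by rewrite -dot_eq0 Dn_root_norm mulf_neq0 ?invr_eq0 ?pnatr_eq0. Qed.

Lemma Dn_lambda1 : lambda1 L = 8 * pi ^+ 2 / c.
Proof.
have [_ PP LP Lh _] := frameP; pose t0 : T := (0, 0, false).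
apply/eqP; rewrite eq_le; apply/andP; split.
  have := lambda1_le (Dn_root_dual t0) (Dn_root_neq0 t0).
  by rewrite Dn_root_norm mulrA (_ : 4 * pi ^+ 2 * 2 = 8 * pi ^+ 2) //; ring.
apply: (lambda1_ge (Dn_root_dual t0) (Dn_root_neq0 t0)) => l l0 Ll.
exact: (eigenvalue_lower_bound c0 PP LP Lh).
Qed.

Lemma sum_lift_pairs (F : 'I_n.+2 -> R) :
  \sum_i \sum_(k < n.+1) (F i + F (lift i k)) = 2 * n.+1%:R * \sum_i F i.
Proof.
transitivity (\sum_i (n%:R * F i + \sum_j F j)).
  apply: eq_bigr => i _; rewrite big_split /= sumr_const card_ord.
  have -> : \sum_j F j = F i + \sum_(k < n.+1) F (lift i k) by rewrite (bigD1_ord i).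
  by rewrite mulrSr mulr_natl addrA.
rewrite big_split /= -mulr_sumr sumr_const card_ord -mulr_natl.
rewrite -![_.+1%:R]natr1; ring.
Qed.

(** Summing over the two signs cancels the cross terms; each frame vector then occurs in [2 * n.+1]
    ordered pairs, and [P^T *m P] is scalar. *)
Lemma Dn_root_tight i j : 4 * pi ^+ 2 * \sum_t Dn_root t 0 i * Dn_root t 0 j =
  8 * pi ^+ 2 / c * (2 * n.+1%:R * (i == j)%:R).
Proof.
have [_ PP _ _ _] := frameP.
have PC : \sum_k P k i * P k j = c * (i == j)%:R.
  have := frame_orthC c0 PP => /matrixP/(_ i j); rewrite !mxE mulr_natr => <-.
  by apply: eq_bigr => k _; rewrite mxE.
have -> : \sum_t Dn_root t 0 i * Dn_root t 0 j =
    2 / c ^+ 2 * \sum_i' \sum_(k < n.+1) (P i' i * P i' j + P (lift i' k) i * P (lift i' k) j).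
  rewrite -(pair_bigA _ (fun tt b => Dn_root (tt, b) 0 i * Dn_root (tt, b) 0 j)) /=.
  rewrite -(pair_bigA _ (fun i' k => \sum_b Dn_root (i', k, b) 0 i * Dn_root (i', k, b) 0 j)) /=.
  rewrite mulr_sumr; apply: eq_bigr => i' _; rewrite mulr_sumr; apply: eq_bigr => k _.
  by rewrite big_bool /= !mxE /= expr1 expr0; field.
rewrite (sum_lift_pairs (fun a => P a i * P a j)) PC; by field.
Qed.

(** At this scale the first eigenvalue equals the dimension [n.+2], as Takahashi's theorem demands,
    and the frame constant equals the number of indices. *)
Lemma Dn_minimal_immersion : c = 8 * pi ^+ 2 / n.+2%:R ->
  lambda1_minimal_immersion L (wave_immersion Dn_root).
Proof.
move=> cE; apply: (@wave_immersion_minimal _ _ _ _ _ (2 / c) (0, 0, false)).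
- exact: Dn_root_dual.
- exact: Dn_root_neq0.
- exact: Dn_root_norm.
- by rewrite Dn_lambda1; field.
move=> i j; rewrite Dn_root_tight !card_prod !card_ord card_bool mulrA; congr (_ * _).
have -> : 8 * pi ^+ 2 / c = n.+2%:R.
  rewrite cE divKf // mulf_neq0 ?pnatr_eq0 // expf_neq0 // gt_eqF //; exact: pi_gt0.
by rewrite !natrM; ring.
Qed.

End DnFrame.

Lemma Dn_minimal (R : realType) (n : nat) (B P : 'M[R]_n.+2) (c : R) :
  Dn_frame (lattice B) P c -> lambda1_minimal B.
Proof.
move=> frameP; have [c0 _ _ _ _] := frameP.
have p0 : 0 < pi :> R := pi_gt0 R.
pose x := 8 * pi ^+ 2 / n.+2%:R / c.
have x0 : 0 < x by rewrite !divr_gt0 ?mulr_gt0 ?exprn_gt0.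
exists (Num.sqrt x); split; first by rewrite sqrtr_gt0.
have := Dn_frame_scale (r := Num.sqrt x) _ frameP.
rewrite sqrtr_gt0 => /(_ x0) h.
exists #|{: ('I_n.+2 * 'I_n.+1 * bool) * bool}|, (wave_immersion (Dn_root (Num.sqrt x *: P) (Num.sqrt x ^+ 2 * c))).
apply: Dn_minimal_immersion => //.
by rewrite sqr_sqrtr ?(ltW x0) // /x divfK // gt_eqF.
Qed.

(** The vectors [2 p_i / c] are dual vectors in one class [a] modulo [2], so halving their sums and
    differences keeps them in the dual lattice. *)
Lemma half_frame_dual (R : realType) (n : nat) (L : set 'rV[R]_n) (P D : 'M[R]_n)
    (c : R) (a : 'rV[int]_n) (W : 'M[int]_n) :
  (forall z : 'rV[int]_n, dual_lattice L (intmx z *m D)) ->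
  (forall i, c^-1 *: row i P = 2^-1 *: (intmx (a + row i W *+ 2) *m D)) ->
  forall i j (s : bool), dual_lattice L (c^-1 *: (row i P + (-1) ^+ s *: row j P)).
Proof.
move=> dualD PE i j s.
have -> : c^-1 *: (row i P + (-1) ^+ s *: row j P) =
    intmx (if s then row i W - row j W else a + row i W + row j W) *m D.
  rewrite scalerDr scalerA mulrC -scalerA !PE scalerA [_ * 2^-1]mulrC -scalerA -scalerDr.
  rewrite !scalemxAl -mulmxDl scalemxAl; congr (_ *m _); apply/rowP => k.
  by case: s; rewrite /= !(mxE, intrD, intrB, mulrnDl) /= ?expr0 ?expr1; field.
exact: dualD.
Qed.

(** * Upper bounds from the Hermite constants of the dual lattice *)

Lemma row_intmx_neq0 (R : realType) (n : nat) (B : 'M[R]_n) (U : 'M[int]_n) i :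
  B \in unitmx -> U \in unitmx -> row i (intmx U *m B) != 0.
Proof.
move=> uB uU; apply/eqP => r0.
have uUB : intmx U *m B \in unitmx by rewrite unitmx_mul intmx_unit.
have := congr1 (fun A => row i A) (mulmxV uUB); rewrite row_mul r0 mul0mx.
by move/rowP/(_ i); rewrite !mxE eqxx => /eqP; rewrite eq_sym oner_eq0.
Qed.

Lemma lambda1_le_dual_rows (R : realType) (n : nat) (B : 'M[R]_n) (U : 'M[int]_n) i :
  B \in unitmx -> U \in unitmx ->
  lambda1 (lattice B) / (4 * pi ^+ 2) <=
  dot (row i (intmx U *m (invmx B)^T)) (row i (intmx U *m (invmx B)^T)).
Proof.
move=> uB uU; set D := (invmx B)^T; have uD : D \in unitmx by rewrite unitmx_tr unitmx_inv.
have p0 : 0 < pi :> R := pi_gt0 R.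
rewrite ler_pdivrMr ?mulr_gt0 ?exprn_gt0 // mulrC; apply: lambda1_le.
  have -> : row i (intmx U *m D) = intmx (row i U) *m D.
    by rewrite row_mul; congr (_ *m _); apply/rowP => k; rewrite !mxE.
  exact: dual_lattice_intmx.
exact: row_intmx_neq0.
Qed.

Lemma powR_third (R : realType) (m V : R) : 0 <= m -> 0 <= V ->
  m * V `^ (2 / 3) = (m ^+ 3 * V ^+ 2) `^ (1 / 3).
Proof.
move=> m0 V0; rewrite powRM ?exprn_ge0 // -!powR_mulrn // -!powRrM; congr (_ * _).
  by rewrite mul1r divff ?pnatr_eq0 // powRr1.
by rewrite mul1r.
Qed.

Lemma powR_half (R : realType) (m V : R) : 0 <= m -> 0 <= V ->
  m * V `^ (2 / 4) = Num.sqrt (m ^+ 2 * V).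
Proof.
move=> m0 V0; rewrite sqrtrM ?sqr_ge0 // sqrtr_sqr ger0_norm // -powR12_sqrt //.
by congr (_ * _ `^ _); field.
Qed.

Lemma lambda1_vol3_le (R : realType) (B : 'M[R]_3) : B \in unitmx ->
  lambda1_vol B <= 4 * 2 `^ (1 / 3) * pi ^+ 2.
Proof.
move=> uB; have p0 : 0 < pi :> R := pi_gt0 R.
pose m := lambda1 (lattice B) / (4 * pi ^+ 2).
have m0 : 0 <= m by rewrite divr_ge0 ?lambda1_ge0 ?mulr_ge0 ?exprn_ge0 // ltW.
have lm : lambda1 (lattice B) = 4 * pi ^+ 2 * m by rewrite mulrC divfK // mulf_neq0 ?expf_neq0 ?gt_eqF.
have dB0 : \det B != 0 by rewrite -unitfE -unitmxE.
pose D := (invmx B)^T.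
have uD : D \in unitmx by rewrite unitmx_tr unitmx_inv.
(* The rank 3 Hermite inequality for the dual lattice, whose Gram determinant is the inverse square
   of the volume. *)
have m3 : m ^+ 3 * volume B ^+ 2 <= 2.
  rewrite /volume real_normK ?num_real //.
  have [->|mn0] := eqVneq m 0; first by rewrite expr0n mul0r.
  have mp : 0 < m by rewrite lt_def mn0.
  have uDD : D *m D^T \in unitmx by rewrite unitmx_mul uD unitmx_tr.
  have := @hermite3 R 3 D m mp uDD (fun U uU i => lambda1_le_dual_rows i uB uU).
  have -> : \det (D *m D^T) = (\det B ^+ 2)^-1.
    by rewrite det_mulmx !det_tr det_inv -invfM.
  by rewrite ler_pdivlMr // exprn_even_gt0.
rewrite /lambda1_vol lm -mulrA powR_third // /volume //.
rewrite [leRHS]mulrAC ler_pM2l ?mulr_gt0 ?exprn_gt0 //.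
apply: ge0_ler_powR => //; rewrite nnegrE //.
by apply: mulr_ge0; apply: exprn_ge0.
Qed.

Lemma lambda1_vol4_le (R : realType) (B : 'M[R]_4) : B \in unitmx ->
  lambda1_vol B <= 4 * Num.sqrt 2 * pi ^+ 2.
Proof.
move=> uB; have p0 : 0 < pi :> R := pi_gt0 R.
pose m := lambda1 (lattice B) / (4 * pi ^+ 2).
have m0 : 0 <= m by rewrite divr_ge0 ?lambda1_ge0 ?mulr_ge0 ?exprn_ge0 // ltW.
have lm : lambda1 (lattice B) = 4 * pi ^+ 2 * m by rewrite mulrC divfK // mulf_neq0 ?expf_neq0 ?gt_eqF.
have dB0 : \det B != 0 by rewrite -unitfE -unitmxE.
pose D := (invmx B)^T.
have uD : D \in unitmx by rewrite unitmx_tr unitmx_inv.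
have m2 : m ^+ 2 * volume B <= 2.
  have := @hermite4 R D m m0 uD (fun U uU i => lambda1_le_dual_rows i uB uU).
  rewrite /D det_tr det_inv exprVn /volume.
  rewrite ler_pdivlMr ?exprn_even_gt0 // -[\det B ^+ 2]real_normK ?num_real //.
  have -> : m ^+ 4 * `|\det B| ^+ 2 = (m ^+ 2 * `|\det B|) ^+ 2 by ring.
  have -> : 4 = 2 ^+ 2 :> R by ring.
  by rewrite ler_sqr ?nnegrE //; apply: mulr_ge0 => //; exact: sqr_ge0.
rewrite /lambda1_vol lm -mulrA powR_half // /volume //.
by rewrite [leRHS]mulrAC ler_pM2l ?mulr_gt0 ?exprn_gt0 // ler_wsqrtr.
Qed.

Definition int_mx (n : nat) (s : seq (seq int)) : 'M[int]_n :=
  \matrix_(i, j) nth 0 (nth [::] s i) j.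

Ltac mx_calc := let i := fresh in let j := fresh in let hi := fresh in let hj := fresh in
  apply/matrixP => i j; rewrite !(mxE, big_ord_recl, big_ord0) /=;
  case: i => [[|[|[|[|i]]]] hi] //=; case: j => [[|[|[|[|j]]]] hj] //=;
  rewrite ?(mxE, big_ord_recl, big_ord0) /=; try field; try lra.

(** * The extremal torus in dimension 3 *)

Section Torus3.
Context {R : realType}.

(* Coordinates, in the basis [D] of the dual lattice and in its dual basis, of
   (multiples of) the three orthogonal vectors spanning a cubic sublattice. *)
Definition cube3 : 'M[int]_3 := int_mx 3 [:: [:: 1; 2; 1]; [:: 1; 0; -1]; [:: 1; 0; 1]].
Definition cocube3 : 'M[int]_3 := int_mx 3 [:: [:: 0; 1; 0]; [:: 1; 0; -1]; [:: 1; -1; 1]].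

(** This identifies [s^-1] times the rows of [cube3 D] with the combinations [cocube3] of the basis
    dual to [D], so they belong to the lattice. *)
Lemma cube3_gram : intmx cube3 *m gram3 R = intmx cocube3.
Proof. by mx_calc. Qed.

Lemma cube3_orth : intmx cocube3 *m (intmx cube3)^T = 2%:M :> 'M[R]_3.
Proof. by mx_calc. Qed.

Lemma det_gram3 : \det (gram3 R) = 2^-1.
Proof. by rewrite det3 /= !mxE !inordK //=; field. Qed.

Lemma Dn_frame3 (B D : 'M[R]_3) (s : R) : B \in unitmx ->
  lattice_basis (dual_lattice (lattice B)) D -> 0 < s -> D *m D^T = s *: gram3 R ->
  Dn_frame (lattice B) (s^-1 *: (intmx cube3 *m D)) (2 / s).
Proof.
move=> uB D_dual s0 DD; have [uD dualE] := D_dual.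
have sn0 : s != 0 by rewrite gt_eqF.
have PE : s^-1 *: (intmx cube3 *m D) = intmx cocube3 *m (invmx D)^T.
  have DE : D = s *: gram3 R *m (invmx D)^T.
    by rewrite -DD -mulmxA -trmx_mul mulVmx // trmx1 mulmx1.
  by rewrite {1}DE mulmxA -scalemxAr -scalemxAl cube3_gram scalerA mulVf // scale1r.
split.
- by rewrite divr_gt0.
- rewrite linearZ /= -scalemxAl -scalemxAr trmx_mul mulmxA -(mulmxA _ D) DD.
  rewrite -scalemxAr -!scalemxAl cube3_gram cube3_orth !scalerA !scale_scalar_mx.
  by congr _%:M; field.
- by move=> z; rewrite PE mulmxA -intmx_mul; exact: dual_basis_lattice.
- rewrite PE mulmxA.
  (* Half the sum of the frame is the first vector of the basis dual to [D]. *)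
  have -> : const_mx 2^-1 *m intmx cocube3 = intmx (delta_mx 0 0) :> 'rV[R]_3.
    by mx_calc.
  exact: dual_basis_lattice.
(* The rows of [cube3] are all congruent to [(1, 0, 1)] modulo [2]. *)
apply: (@half_frame_dual _ _ _ _ D _ (row 0 (int_mx 3 [:: [:: 1; 0; 1]]))
  (int_mx 3 [:: [:: 0; 1; 0]; [:: 0; 0; -1]; [:: 0; 0; 0]])).
  by move=> z; rewrite dualE; exists z.
move=> i; rewrite linearZ /= scalerA row_mul invf_div mulrAC divff // mul1r.
congr (_ *: (_ *m _)); apply/rowP => j; rewrite !mxE.
by case: i => [[|[|[|i]]] hi] //=; case: j => [[|[|[|j]]] hj].
Qed.

Lemma lambda1_vol3_eq (B : 'M[R]_3) : B \in unitmx -> dual_has_gram B (gram3 R) ->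
  lambda1_minimal B /\ lambda1_vol B = 4 * 2 `^ (1 / 3) * pi ^+ 2.
Proof.
move=> uB [D [D_dual [s [s0 DD]]]].
have sn0 : s != 0 by rewrite gt_eqF.
have frameP := Dn_frame3 uB D_dual s0 DD.
split; first exact: Dn_minimal frameP.
have VD := det_dual_basis uB D_dual.
have D2 : `|\det D| ^+ 2 = s ^+ 3 / 2.
  by rewrite real_normK ?num_real // expr2 -{2}det_tr -det_mulmx DD detZ det_gram3.
have V2 : s ^+ 3 * `|\det B| ^+ 2 = 2.
  have : `|\det B| ^+ 2 * (s ^+ 3 / 2) = 1 by rewrite -D2 -exprMn VD expr1n.
  by lra.
rewrite /lambda1_vol (Dn_lambda1 frameP) /volume.
have -> : 8 * pi ^+ 2 / (2 / s) = 4 * pi ^+ 2 * s by field.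
by rewrite -mulrA powR_third ?(ltW s0) // V2 mulrAC.
Qed.

Lemma exists_torus3 : exists B : 'M[R]_3, B \in unitmx /\ dual_has_gram B (gram3 R).
Proof.
(* The rows of [D] are simple roots of D_3 = A_3. *)
pose D : 'M[R]_3 := intmx (int_mx 3 [:: [:: 1; -1; 0]; [:: 0; 1; -1]; [:: -1; -1; 0]]).
have DD : D *m D^T = 2 *: gram3 R by mx_calc.
have uD : D \in unitmx.
  have : D *m D^T \in unitmx.
    by rewrite unitmxE unitfE DD detZ det_gram3 mulf_neq0 ?expf_neq0 ?invr_eq0 ?pnatr_eq0.
  by rewrite unitmx_mul => /andP[].
have uB : (invmx D)^T \in unitmx by rewrite unitmx_tr unitmx_inv.
have DE : (invmx (invmx D)^T)^T = D by rewrite trmx_inv trmxK invmxK.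
exists (invmx D)^T; split => //; exists D; split; last by exists 2; split.
split => //; apply/seteqP; split => v.
  by move=> /(mem_dual_lattice uB); rewrite DE.
by move=> [z ->]; have := dual_lattice_intmx z uB; rewrite DE.
Qed.

End Torus3.

(** * The extremal torus in dimension 4 *)

Section Torus4.
Context {R : realType}.

(** The lattice of [basis4] is D_4, the integer vectors with even coordinate sum. These are four
    orthogonal roots in it, with half-sum [e1 + e3]. *)
Definition cube4 : 'M[int]_4 := int_mx 4 [:: [:: 1; 1; 0; 0]; [:: 1; -1; 0; 0];
  [:: 0; 0; 1; 1]; [:: 0; 0; 1; -1]].

Lemma det_basis4 : \det (basis4 R) = 2.
Proof.
rewrite -det_tr det_trig.
  by rewrite !big_ord_recl big_ord0 !mxE /= !mul1r mulr1.
apply/is_trig_mxP => i j; rewrite !mxE.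
by case: i => [[|[|[|[|i]]]] hi] //=; case: j => [[|[|[|[|j]]]] hj].
Qed.

Lemma basis4_unit : basis4 R \in unitmx.
Proof. by rewrite unitmxE det_basis4 unitfE pnatr_eq0. Qed.

Lemma cube4_basis4 : intmx cube4 =
  intmx (int_mx 4 [:: [:: 1; 1; 0; 1]; [:: 1; -1; 0; 0]; [:: 0; 0; 1; 1]; [:: 0; 0; 1; 0]])
    *m basis4 R.
Proof. by mx_calc. Qed.

Lemma Dn_frame4 : Dn_frame (lattice (basis4 R)) (intmx cube4) 2.
Proof.
have u4 := basis4_unit.
split=> //.
- by mx_calc.
- by move=> z; rewrite cube4_basis4 mulmxA -intmx_mul; eexists.
- exists (row 0 (int_mx 4 [:: [:: 1; 0; 1; 1]])); by mx_calc.
(* The products of the rows of [cube4] with the rows of [basis4] are all congruent to [(1, 1, 0, 0)]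
   modulo [2]. *)
apply: (@half_frame_dual _ _ _ _ (invmx (basis4 R))^T _ (row 0 (int_mx 4 [:: [:: 1; 1; 0; 0]]))
  (int_mx 4 [:: [:: 0; 0; 0; 0]; [:: 0; -1; 0; 0]; [:: -1; -1; 0; 1]; [:: 0; 0; 1; -1]])).
  by move=> z; exact: dual_lattice_intmx.
have bT : (basis4 R)^T \in unitmx by rewrite unitmx_tr.
move=> i; congr (_ *: _); rewrite trmx_inv; apply: (can_inj (mulmxK bT)).
rewrite mulmxKV //; apply/rowP => j; rewrite !(mxE, big_ord_recl, big_ord0) /=.
by case: i => [[|[|[|[|i]]]] hi] //=; case: j => [[|[|[|[|j]]]] hj] //=; rewrite ?mxE /=; lra.
Qed.

Lemma lambda1_vol4_eq (r : R) : 0 < r -> lambda1_minimal (r *: basis4 R) /\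
  lambda1_vol (r *: basis4 R) = 4 * Num.sqrt 2 * pi ^+ 2.
Proof.
move=> r0; have frameP := Dn_frame_scale r0 Dn_frame4.
split; first exact: Dn_minimal frameP.
have rn0 : r != 0 by rewrite gt_eqF.
rewrite /lambda1_vol (Dn_lambda1 frameP) /volume detZ det_basis4.
have -> : 8 * pi ^+ 2 / (r ^+ 2 * 2) = 4 * pi ^+ 2 * (r ^+ 2)^-1 by field.
rewrite -mulrA powR_half // ?invr_ge0 ?sqr_ge0 // mulrAC; congr (_ * Num.sqrt _ * _).
by rewrite ger0_norm ?mulr_ge0 ?exprn_ge0 ?(ltW r0) //; field.
Qed.

End Torus4.

Theorem theorem1 (R : realType) :
  ((forall B : 'M[R]_3, B \in unitmx ->
      lambda1_vol B <= 4 * 2 `^ (1 / 3) * pi ^+ 2) /\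
   (exists B : 'M[R]_3, B \in unitmx /\ dual_has_gram B (gram3 R)) /\
   (forall B : 'M[R]_3, B \in unitmx -> dual_has_gram B (gram3 R) ->
      lambda1_minimal B /\
      lambda1_vol B = 4 * 2 `^ (1 / 3) * pi ^+ 2))
  /\
  ((forall B : 'M[R]_4, B \in unitmx ->
      lambda1_vol B <= 4 * Num.sqrt 2 * pi ^+ 2) /\
   (basis4 R \in unitmx /\
    forall r : R, 0 < r ->
      lambda1_minimal (r *: basis4 R) /\
      lambda1_vol (r *: basis4 R) = 4 * Num.sqrt 2 * pi ^+ 2)).
Proof.
split; split.
- exact: lambda1_vol3_le.
- by split; [exact: exists_torus3|exact: lambda1_vol3_eq].
- exact: lambda1_vol4_le.
- by split; [exact: basis4_unit|exact: lambda1_vol4_eq].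
Qed.
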